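(* Assume $\Lambda\subset(0,\infty)$ and a family of disjoint intervals $I_k=(a_k,b_k)\subset(0,\infty)$, $0<a_1<b_1<\cdots$, $a_k\nearrow+\infty$, is substantial for some increasing function $\Psi(s)\nearrow\infty$. Then $\Lambda$ is a uniqueness set for $B_\sigma$ whenever $\sigma$ satisfies: (a) $\sigma(x)\le \frac{1}{2e}\Psi\bigl(\frac{x}{2e}\bigr)$ for all $x$; and (b) there exists a sequence of integers $n_j\to\infty$ such that $\frac{1}{\sigma(2b_{n_j})}\sum_{k=1}^{n_j}\Psi(b_k-a_k)\left(\frac{b_k-a_k}{b_k}\right)^2\to\infty$ as $j\to\infty$.
   Context: For a monotone function $\sigma$ on $(0,\infty)$ with $\sigma(y)\nearrow\infty$, the generalized Bernstein class is $B_\sigma=\{F$ entire$: |F(x+iy)|\le C_F e^{|y|\sigma(|y|)}, x+iy\in\mathbb{C}\}$, with $C_F>0$ a constant depending on $F$. A family of disjoint intervals $(a_k,b_k)$ is substantial for an increasing function $\Psi$ if $n_\Lambda(a_k,b_k)/(b_k-a_k)>\Psi(b_k-a_k)$ for all $k$ (where $n_\Lambda(I)$ is the number of points of $\Lambda$ in $I$) and $\sum_k((b_k-a_k)/b_k)^2=+\infty$. $\Lambda$ being a uniqueness set for $B_\sigma$ means that $F\in B_\sigma$ and $F|_\Lambda=0$ imply $F\equiv0$. *)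

(* Defs.v *)
From Stdlib Require Import Reals List.
From Coquelicot Require Import Coquelicot.
Open Scope R_scope.

Definition entire (F : C -> C) : Prop :=
  forall z : C, @ex_derive C_AbsRing C_NormedModule F z.

Definition in_B (sigma : R -> R) (F : C -> C) : Prop :=
  entire F /\
  exists CF : R, 0 < CF /\
    forall z : C, Cmod (F z) <= CF * exp (Rabs (Im z) * sigma (Rabs (Im z))).

Definition uniqueness_set (Lam : R -> Prop) (sigma : R -> R) : Prop :=
  forall F : C -> C, in_B sigma F ->
    (forall x : R, Lam x -> F (RtoC x) = 0) -> forall z : C, F z = 0.

(* n_Lambda(a,b) > t : there are more than t points of Lambda in (a,b)
   (the count may be infinite; "more than t" = some finite set of
   distinct such points has more than t elements). *)
Definition count_gt (Lam : R -> Prop) (a b t : R) : Prop :=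
  exists l : list R, NoDup l /\
    (forall x, In x l -> Lam x /\ a < x < b) /\ t < INR (length l).

Definition substantial (Lam : R -> Prop) (Psi : R -> R) (a b : nat -> R) : Prop :=
  (forall k, (1 <= k)%nat ->
     count_gt Lam (a k) (b k) (Psi (b k - a k) * (b k - a k))) /\
  is_lim_seq (fun n => sum_n_m (fun k => ((b k - a k) / b k) ^ 2) 1 n) p_infty.

(* Main.v *)
(* A function F of the Bernstein class with N zeros in an interval I of length
   l = b - a is small on I: dividing out the zeros and applying the maximum
   modulus principle on the square of half-side 2 e l about the midpoint gives,
   by (a), |F| <= C exp (l Psi(l) - 5 N / 4) <= C exp (- l Psi(l) / 4) on I.

   In the strip 0 <= Im z <= Y = 2 b_n the function F(z) exp (i sigma(Y) z) is
   bounded by C.  Multiply it by exp (sum_k m_k G_k), where m_k is comparable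
   to l_k Psi(l_k) and Re G_k is a harmonic function which is at most 3 on I_k,
   nonpositive on the rest of the real line and on the line Im z = Y, and at
   least c Im z0 * l_k / b_k^2 at a fixed z0 of the upper half-plane.  The
   product is still bounded by C on the boundary, whence
     |F(z0)| <= C exp (Im z0 (sigma(2 b_n) - c sum_k Psi(l_k) (l_k / b_k)^2 + O(1))),
   and (b) forces F(z0) = 0.  The first step, applied with arbitrarily many
   zeros, then gives F = 0 in the rest of the plane.

   The maximum modulus principle on rectangles is derived from Goursat's
   theorem for real line integrals. *)
Require Import Defs.
From Stdlib Require Import Reals List FinFun Lra Lia Classical ClassicalEpsilon.
From Coquelicot Require Import Coquelicot.
Open Scope R_scope.

(** * Complex differentiability in epsilon-delta form *)

(** Harmonic measure of the intervals is replaced by explicit rational functions, so that each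
    estimate becomes an inequality between polynomials. Under w = - 1 / z the interval (a, b)
    becomes one of length (b - a) / (a b), at least (b - a) / b^2, and distant intervals shrink
    towards 0. This is where the weight in (b) comes from: one factor l_k is in the decay exponent
    l_k Psi(l_k), the other in this length, which is the strength with which the interval is felt at
    a fixed z0.

    Dividing out zeros leaves quotients that are known to be continuous, but not differentiable, at
    the zeros. The chain from Goursat to the maximum principle is therefore carried out for
    functions that are continuous everywhere and differentiable off a finite set. Cauchy's formula
    enters as the vanishing of the contour integral of a difference quotient, from which a crude
    bound on f(z0) is read off side by side. *)

Definition Ccont (f : C -> C) (z : C) : Prop :=
  forall eps, 0 < eps -> exists delta, 0 < delta /\
    forall w, Cmod (w - z) < delta -> Cmod (f w - f z) < eps.

Definition Cder (f : C -> C) (z l : C) : Prop :=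
  forall eps, 0 < eps -> exists delta, 0 < delta /\
    forall w, Cmod (w - z) < delta ->
      Cmod (f w - f z - l * (w - z)) <= eps * Cmod (w - z).

Definition Cdiff (f : C -> C) (z : C) : Prop := exists l, Cder f z l.

Lemma Cdiff_ex_derive (f : C -> C) (z : C) :
  @ex_derive C_AbsRing C_NormedModule f z -> Cdiff f z.
Proof.
  intros [l [_ Hd]]. exists l. intros eps Heps.
  destruct (Hd z (fun P HP => HP) (mkposreal eps Heps)) as [d Hd'].
  exists d; split; [apply cond_pos|]. intros w Hw.
  specialize (Hd' w Hw).
  replace (f w - f z - l * (w - z))%C with (f w - f z - (w - z) * l)%C by ring.
  exact Hd'.
Qed.

Lemma Cmod_minus_sym (z w : C) : Cmod (z - w) = Cmod (w - z).
Proof. rewrite <- Cmod_opp. f_equal. ring. Qed.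

Lemma Cmod_triangle_inv (z w : C) : Cmod z - Cmod w <= Cmod (z - w).
Proof.
  assert (H := Cmod_triangle (z - w) w).
  replace (z - w + w)%C with z in H by ring. lra.
Qed.

Lemma Cmod_minus_triangle (z w : C) : Cmod (z - w) <= Cmod z + Cmod w.
Proof. unfold Cminus. rewrite <- (Cmod_opp w). apply Cmod_triangle. Qed.

Lemma Cder_lipschitz (f : C -> C) (z l : C) : Cder f z l ->
  exists delta, 0 < delta /\ forall w, Cmod (w - z) < delta ->
    Cmod (f w - f z) <= (Cmod l + 1) * Cmod (w - z).
Proof.
  intros H. destruct (H 1 Rlt_0_1) as [d [Hd Hw]].
  exists d; split; [exact Hd|]. intros w Hwd. specialize (Hw w Hwd).
  assert (H1 := Cmod_triangle (f w - f z - l * (w - z)) (l * (w - z))).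
  rewrite Cmod_mult in H1.
  replace (f w - f z - l * (w - z) + l * (w - z))%C with (f w - f z)%C in H1 by ring.
  lra.
Qed.

Lemma Cder_Ccont (f : C -> C) (z l : C) : Cder f z l -> Ccont f z.
Proof.
  intros H eps Heps. destruct (Cder_lipschitz f z l H) as [d [Hd Hw]].
  assert (Hl := Cmod_ge_0 l).
  assert (Hq : 0 < eps / (Cmod l + 1)) by (apply Rdiv_lt_0_compat; lra).
  exists (Rmin d (eps / (Cmod l + 1))). split; [now apply Rmin_pos|].
  intros w Hwd.
  eapply Rle_lt_trans; [apply Hw; eapply Rlt_le_trans; [exact Hwd|apply Rmin_l]|].
  apply Rlt_le_trans with ((Cmod l + 1) * (eps / (Cmod l + 1))).
  - apply Rmult_lt_compat_l; [lra|]. eapply Rlt_le_trans; [exact Hwd|apply Rmin_r].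
  - right. field. lra.
Qed.

Lemma Cdiff_Ccont (f : C -> C) (z : C) : Cdiff f z -> Ccont f z.
Proof. intros [l H]. exact (Cder_Ccont f z l H). Qed.

Lemma Ccont_const (c z : C) : Ccont (fun _ => c) z.
Proof.
  intros eps H. exists 1. split; [lra|]. intros w _.
  replace (c - c)%C with (RtoC 0) by ring. rewrite Cmod_0. exact H.
Qed.

Lemma Cder_const (c z : C) : Cder (fun _ => c) z 0.
Proof.
  intros eps H. exists 1. split; [lra|]. intros w _.
  replace (c - c - 0 * (w - z))%C with (RtoC 0) by ring.
  rewrite Cmod_0. apply Rmult_le_pos; [lra|apply Cmod_ge_0].
Qed.

Lemma Cder_id (z : C) : Cder (fun w => w) z 1.
Proof.
  intros eps H. exists 1. split; [lra|]. intros w _.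
  replace (w - z - 1 * (w - z))%C with (RtoC 0) by ring.
  rewrite Cmod_0. apply Rmult_le_pos; [lra|apply Cmod_ge_0].
Qed.

Lemma Cder_plus (f g : C -> C) (z l m : C) :
  Cder f z l -> Cder g z m -> Cder (fun w => f w + g w)%C z (l + m)%C.
Proof.
  intros Hf Hg eps H.
  destruct (Hf (eps / 2)) as [d1 [Hd1 H1]]; [lra|].
  destruct (Hg (eps / 2)) as [d2 [Hd2 H2]]; [lra|].
  exists (Rmin d1 d2). split; [now apply Rmin_pos|]. intros w Hw.
  specialize (H1 w (Rlt_le_trans _ _ _ Hw (Rmin_l _ _))).
  specialize (H2 w (Rlt_le_trans _ _ _ Hw (Rmin_r _ _))).
  replace (f w + g w - (f z + g z) - (l + m) * (w - z))%C
    with ((f w - f z - l * (w - z)) + (g w - g z - m * (w - z)))%C by ring.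
  eapply Rle_trans; [apply Cmod_triangle|]. lra.
Qed.

Lemma Ccont_mult (f g : C -> C) (z : C) :
  Ccont f z -> Ccont g z -> Ccont (fun w => f w * g w)%C z.
Proof.
  intros Hf Hg eps H.
  set (A := Cmod (f z) + 1). set (B := Cmod (g z) + 1).
  assert (HA : 0 < A) by (unfold A; assert (Hp := Cmod_ge_0 (f z)); lra).
  assert (HB : 0 < B) by (unfold B; assert (Hp := Cmod_ge_0 (g z)); lra).
  assert (Ea : 0 < eps / (2 * A)) by (apply Rdiv_lt_0_compat; lra).
  assert (Eb : 0 < eps / (2 * B)) by (apply Rdiv_lt_0_compat; lra).
  destruct (Hf (Rmin 1 (eps / (2 * B)))) as [d1 [Hd1 H1]]; [apply Rmin_pos; lra|].
  destruct (Hg (eps / (2 * A)) Ea) as [d2 [Hd2 H2]].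
  exists (Rmin d1 d2). split; [now apply Rmin_pos|]. intros w Hw.
  specialize (H1 w (Rlt_le_trans _ _ _ Hw (Rmin_l _ _))).
  specialize (H2 w (Rlt_le_trans _ _ _ Hw (Rmin_r _ _))).
  assert (H1a := Rlt_le_trans _ _ _ H1 (Rmin_l _ _)).
  assert (H1b := Rlt_le_trans _ _ _ H1 (Rmin_r _ _)).
  assert (Hfw : Cmod (f w) <= A).
  { unfold A. assert (Ht := Cmod_triangle_inv (f w) (f z)). lra. }
  replace (f w * g w - f z * g z)%C
    with (f w * (g w - g z) + g z * (f w - f z))%C by ring.
  eapply Rle_lt_trans; [apply Cmod_triangle|]. rewrite !Cmod_mult.
  assert (X1 : Cmod (f w) * Cmod (g w - g z) <= A * (eps / (2 * A))).
  { apply Rmult_le_compat; try apply Cmod_ge_0; lra. }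
  assert (X2 : Cmod (g z) * Cmod (f w - f z) < B * (eps / (2 * B))).
  { apply Rle_lt_trans with (Cmod (g z) * (eps / (2 * B))).
    - apply Rmult_le_compat_l; [apply Cmod_ge_0|lra].
    - apply Rmult_lt_compat_r; [lra|unfold B; lra]. }
  replace (A * (eps / (2 * A))) with (eps / 2) in X1 by (field; lra).
  replace (B * (eps / (2 * B))) with (eps / 2) in X2 by (field; lra).
  lra.
Qed.

Lemma Cder_mult (f g : C -> C) (z l m : C) :
  Cder f z l -> Cder g z m ->
  Cder (fun w => f w * g w)%C z (l * g z + f z * m)%C.
Proof.
  intros Hf Hg eps H.
  set (A := Cmod (f z) + 1). set (B := Cmod (g z) + 1). set (L := Cmod l + 1).
  assert (HA : 0 < A) by (unfold A; assert (Hp := Cmod_ge_0 (f z)); lra).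
  assert (HB : 0 < B) by (unfold B; assert (Hp := Cmod_ge_0 (g z)); lra).
  assert (HL : 0 < L) by (unfold L; assert (Hp := Cmod_ge_0 l); lra).
  destruct (Hf (eps / (3 * B))) as [d1 [Hd1 H1]]; [apply Rdiv_lt_0_compat; lra|].
  destruct (Hg (eps / (3 * A))) as [d2 [Hd2 H2]]; [apply Rdiv_lt_0_compat; lra|].
  destruct (Cder_lipschitz f z l Hf) as [d3 [Hd3 H3]].
  destruct (Cder_Ccont g z m Hg (eps / (3 * L))) as [d4 [Hd4 H4]];
    [apply Rdiv_lt_0_compat; lra|].
  exists (Rmin (Rmin d1 d2) (Rmin d3 d4)).
  split; [repeat apply Rmin_pos; assumption|]. intros w Hw.
  assert (Hw1 := Rlt_le_trans _ _ _ Hw (Rmin_l _ _)).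
  assert (Hw2 := Rlt_le_trans _ _ _ Hw (Rmin_r _ _)).
  specialize (H1 w (Rlt_le_trans _ _ _ Hw1 (Rmin_l _ _))).
  specialize (H2 w (Rlt_le_trans _ _ _ Hw1 (Rmin_r _ _))).
  specialize (H3 w (Rlt_le_trans _ _ _ Hw2 (Rmin_l _ _))).
  specialize (H4 w (Rlt_le_trans _ _ _ Hw2 (Rmin_r _ _))).
  set (D := Cmod (w - z)) in *.
  assert (HD : 0 <= D) by apply Cmod_ge_0.
  (* Each of the three terms takes a third of eps; the last one is small because f is Lipschitz at z
     and g is continuous there. *)
  replace (f w * g w - f z * g z - (l * g z + f z * m) * (w - z))%C
    with (g z * (f w - f z - l * (w - z)) + f z * (g w - g z - m * (w - z))
          + (f w - f z) * (g w - g z))%C by ring.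
  eapply Rle_trans; [apply Cmod_triangle|].
  eapply Rle_trans; [apply Rplus_le_compat_r; apply Cmod_triangle|].
  rewrite !Cmod_mult.
  assert (X1 : Cmod (g z) * Cmod (f w - f z - l * (w - z)) <= B * (eps / (3 * B) * D)).
  { apply Rmult_le_compat; try apply Cmod_ge_0; [unfold B; lra|exact H1]. }
  assert (X2 : Cmod (f z) * Cmod (g w - g z - m * (w - z)) <= A * (eps / (3 * A) * D)).
  { apply Rmult_le_compat; try apply Cmod_ge_0; [unfold A; lra|exact H2]. }
  assert (X3 : Cmod (f w - f z) * Cmod (g w - g z) <= (L * D) * (eps / (3 * L))).
  { apply Rmult_le_compat; try apply Cmod_ge_0; [exact H3|lra]. }
  replace (B * (eps / (3 * B) * D)) with (eps * D / 3) in X1 by (field; lra).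
  replace (A * (eps / (3 * A) * D)) with (eps * D / 3) in X2 by (field; lra).
  replace (L * D * (eps / (3 * L))) with (eps * D / 3) in X3 by (field; lra).
  lra.
Qed.

Lemma Cder_comp (f g : C -> C) (z l m : C) :
  Cder f z l -> Cder g (f z) m -> Cder (fun w => g (f w)) z (m * l)%C.
Proof.
  intros Hf Hg eps H.
  set (L := Cmod l + 1). set (M := Cmod m + 1).
  assert (HL : 0 < L) by (unfold L; assert (Hp := Cmod_ge_0 l); lra).
  assert (HM : 0 < M) by (unfold M; assert (Hp := Cmod_ge_0 m); lra).
  destruct (Hg (eps / (2 * L))) as [d1 [Hd1 H1]]; [apply Rdiv_lt_0_compat; lra|].
  destruct (Hf (eps / (2 * M))) as [d2 [Hd2 H2]]; [apply Rdiv_lt_0_compat; lra|].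
  destruct (Cder_lipschitz f z l Hf) as [d3 [Hd3 H3]].
  destruct (Cder_Ccont f z l Hf d1 Hd1) as [d4 [Hd4 H4]].
  exists (Rmin d2 (Rmin d3 d4)).
  split; [repeat apply Rmin_pos; assumption|]. intros w Hw.
  assert (Hw2 := Rlt_le_trans _ _ _ Hw (Rmin_r _ _)).
  specialize (H2 w (Rlt_le_trans _ _ _ Hw (Rmin_l _ _))).
  specialize (H3 w (Rlt_le_trans _ _ _ Hw2 (Rmin_l _ _))).
  specialize (H4 w (Rlt_le_trans _ _ _ Hw2 (Rmin_r _ _))).
  specialize (H1 (f w) H4).
  set (D := Cmod (w - z)) in *.
  replace (g (f w) - g (f z) - m * l * (w - z))%C
    with ((g (f w) - g (f z) - m * (f w - f z)) + m * (f w - f z - l * (w - z)))%C by ring.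
  eapply Rle_trans; [apply Cmod_triangle|]. rewrite Cmod_mult.
  assert (X1 : eps / (2 * L) * Cmod (f w - f z) <= eps / (2 * L) * (L * D)).
  { apply Rmult_le_compat_l; [|exact H3]. left. apply Rdiv_lt_0_compat; lra. }
  assert (X2 : Cmod m * Cmod (f w - f z - l * (w - z)) <= M * (eps / (2 * M) * D)).
  { apply Rmult_le_compat; try apply Cmod_ge_0; [unfold M; lra|exact H2]. }
  replace (eps / (2 * L) * (L * D)) with (eps * D / 2) in X1 by (field; lra).
  replace (M * (eps / (2 * M) * D)) with (eps * D / 2) in X2 by (field; lra).
  lra.
Qed.

Lemma Cminus_neq_0 (z w : C) : z <> w -> (z - w)%C <> 0.
Proof.
  intros H E. apply H. replace z with ((z - w) + w)%C by ring. rewrite E. ring.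
Qed.

Lemma Cder_inv (z : C) : z <> 0 -> Cder Cinv z (- / (z * z))%C.
Proof.
  intros Hz eps H. set (A := Cmod z).
  assert (HA : 0 < A) by now apply Cmod_gt_0.
  (* The first radius keeps |w| above A / 2; the second then bounds the remainder |w - z|^2 / (A^2
     |w|). *)
  exists (Rmin (A / 2) (eps * (A * A * A) / 2)). split.
  { apply Rmin_pos; [lra|]. repeat apply Rmult_lt_0_compat; lra. }
  intros w Hw.
  assert (Hw1 := Rlt_le_trans _ _ _ Hw (Rmin_l _ _)).
  assert (Hw2 := Rlt_le_trans _ _ _ Hw (Rmin_r _ _)).
  assert (HwA : A / 2 < Cmod w).
  { assert (Ht := Cmod_triangle_inv z w). rewrite Cmod_minus_sym in Ht.
    fold A in Ht. lra. }
  assert (Hw0 : w <> 0) by (apply Cmod_gt_0; lra).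
  replace (/ w - / z - - / (z * z) * (w - z))%C
    with ((w - z) * (w - z) * / (z * z * w))%C.
  2:{ field. now split. }
  rewrite !Cmod_mult, Cmod_inv, !Cmod_mult.
  2:{ apply Cmod_gt_0. rewrite !Cmod_mult. repeat apply Rmult_lt_0_compat; fold A; lra. }
  fold A. set (D := Cmod (w - z)) in *.
  assert (HD : 0 <= D) by apply Cmod_ge_0.
  rewrite (Rmult_comm eps D), Rmult_assoc.
  apply Rmult_le_compat_l; [exact HD|].
  assert (HP : 0 < A * A * Cmod w) by (repeat apply Rmult_lt_0_compat; lra).
  apply (Rmult_le_reg_r (A * A * Cmod w)); [exact HP|].
  rewrite Rmult_assoc, Rinv_l, Rmult_1_r; [|lra].
  apply Rle_trans with (eps * (A * A * (A / 2))); [lra|].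
  apply Rmult_le_compat_l; [lra|]. apply Rmult_le_compat_l; [|lra].
  left; apply Rmult_lt_0_compat; lra.
Qed.

Lemma Cdiff_const (c z : C) : Cdiff (fun _ => c) z.
Proof. eexists. apply Cder_const. Qed.

Lemma Cdiff_id (z : C) : Cdiff (fun w => w) z.
Proof. eexists. apply Cder_id. Qed.

Lemma Cdiff_plus (f g : C -> C) (z : C) :
  Cdiff f z -> Cdiff g z -> Cdiff (fun w => f w + g w)%C z.
Proof. intros [l Hl] [m Hm]. eexists. apply Cder_plus; eassumption. Qed.

Lemma Cdiff_mult (f g : C -> C) (z : C) :
  Cdiff f z -> Cdiff g z -> Cdiff (fun w => f w * g w)%C z.
Proof. intros [l Hl] [m Hm]. eexists. apply Cder_mult; eassumption. Qed.

Lemma Cdiff_comp (f g : C -> C) (z : C) :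
  Cdiff f z -> Cdiff g (f z) -> Cdiff (fun w => g (f w)) z.
Proof. intros [l Hl] [m Hm]. eexists. apply Cder_comp; eassumption. Qed.

Lemma Cdiff_inv (f : C -> C) (z : C) :
  Cdiff f z -> f z <> 0 -> Cdiff (fun w => / f w)%C z.
Proof.
  intros Hf H0. apply (Cdiff_comp f Cinv); [exact Hf|].
  eexists. now apply Cder_inv.
Qed.

Lemma Cdiff_minus (f g : C -> C) (z : C) :
  Cdiff f z -> Cdiff g z -> Cdiff (fun w => f w - g w)%C z.
Proof.
  intros Hf [m Hm]. apply (Cdiff_plus f (fun w => - g w)%C); [exact Hf|].
  exists (- m)%C. intros eps He. destruct (Hm eps He) as [d [Hd Hw]].
  exists d. split; [exact Hd|]. intros w Hwd.
  rewrite <- Cmod_opp.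
  replace (- (- g w - - g z - - m * (w - z)))%C with (g w - g z - m * (w - z))%C by ring.
  now apply Hw.
Qed.

Lemma Ccont_pow (f : C -> C) (n : nat) (z : C) :
  Ccont f z -> Ccont (fun w => f w ^ n)%C z.
Proof.
  intros H. induction n as [|n IH].
  - exact (Ccont_const 1%C z).
  - exact (Ccont_mult f (fun w => f w ^ n)%C z H IH).
Qed.

Lemma Cdiff_pow (f : C -> C) (n : nat) (z : C) :
  Cdiff f z -> Cdiff (fun w => f w ^ n)%C z.
Proof.
  intros H. induction n as [|n IH].
  - exact (Cdiff_const 1%C z).
  - exact (Cdiff_mult f (fun w => f w ^ n)%C z H IH).
Qed.

Lemma Ccont_eq_local (f g : C -> C) (z : C) (r : R) : 0 < r ->
  (forall w, Cmod (w - z) < r -> f w = g w) -> Ccont f z -> Ccont g z.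
Proof.
  intros Hr E Hf eps He. destruct (Hf eps He) as [d [Hd H]].
  assert (Hz : f z = g z).
  { apply E. replace (z - z)%C with (RtoC 0) by ring. now rewrite Cmod_0. }
  exists (Rmin d r). split; [now apply Rmin_pos|]. intros w Hw.
  rewrite <- Hz, <- E.
  - apply H. eapply Rlt_le_trans; [exact Hw|apply Rmin_l].
  - eapply Rlt_le_trans; [exact Hw|apply Rmin_r].
Qed.

Lemma Cdiff_eq_local (f g : C -> C) (z : C) (r : R) : 0 < r ->
  (forall w, Cmod (w - z) < r -> f w = g w) -> Cdiff f z -> Cdiff g z.
Proof.
  intros Hr E [l Hf]. exists l. intros eps He. destruct (Hf eps He) as [d [Hd H]].
  assert (Hz : f z = g z).
  { apply E. replace (z - z)%C with (RtoC 0) by ring. now rewrite Cmod_0. }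
  exists (Rmin d r). split; [now apply Rmin_pos|]. intros w Hw.
  rewrite <- Hz, <- E.
  - apply H. eapply Rlt_le_trans; [exact Hw|apply Rmin_l].
  - eapply Rlt_le_trans; [exact Hw|apply Rmin_r].
Qed.

(** * Holomorphy off a finite set and difference quotients *)

(** [S] lists the points where only continuity is known; every division by a zero adds one point to
    it. *)
Definition hol (U : C -> Prop) (S : list C) (f : C -> C) : Prop :=
  forall z, U z -> Ccont f z /\ (~ In z S -> Cdiff f z).

(** The value [l] is meant to be the derivative at [z0], which makes the quotient continuous there.
    It serves both to divide out a zero and as the integrand of Cauchy's formula. *)
Definition diff_quot (f : C -> C) (z0 l z : C) : C :=
  if excluded_middle_informative (z = z0) then l else ((f z - f z0) / (z - z0))%C.

Lemma diff_quot_neq (f : C -> C) (z0 l z : C) : z <> z0 ->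
  diff_quot f z0 l z = ((f z - f z0) / (z - z0))%C.
Proof.
  intros H. unfold diff_quot. destruct (excluded_middle_informative (z = z0)); [contradiction|reflexivity].
Qed.

Lemma diff_quot_eq_local (f : C -> C) (z0 l z : C) : z <> z0 ->
  0 < Cmod (z - z0) /\ forall w, Cmod (w - z) < Cmod (z - z0) ->
    ((f w - f z0) * / (w - z0))%C = diff_quot f z0 l w.
Proof.
  intros H. split; [now apply Cmod_gt_0, Cminus_neq_0|]. intros w Hw.
  rewrite diff_quot_neq; [reflexivity|]. intros ->. rewrite Cmod_minus_sym in Hw. lra.
Qed.

Lemma Ccont_diff_quot_at (f : C -> C) (z0 l : C) : Cder f z0 l -> Ccont (diff_quot f z0 l) z0.
Proof.
  intros H eps He. destruct (H (eps / 2)) as [d [Hd Hw]]; [lra|].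
  exists d. split; [exact Hd|]. intros w Hwd. specialize (Hw w Hwd).
  replace (diff_quot f z0 l z0) with l.
  2:{ unfold diff_quot. now destruct (excluded_middle_informative (z0 = z0)). }
  destruct (excluded_middle_informative (w = z0)) as [->|Hne].
  - unfold diff_quot. destruct (excluded_middle_informative (z0 = z0)); [|contradiction].
    replace (l - l)%C with (RtoC 0) by ring. now rewrite Cmod_0.
  - rewrite diff_quot_neq by exact Hne.
    assert (Hn := Cminus_neq_0 _ _ Hne).
    assert (Hp := proj1 (Cmod_gt_0 _) Hn).
    replace ((f w - f z0) / (w - z0) - l)%C
      with ((f w - f z0 - l * (w - z0)) / (w - z0))%C by (field; exact Hn).
    rewrite Cmod_div by exact Hn.
    apply Rle_lt_trans with (eps / 2); [|lra].
    apply (Rmult_le_reg_r (Cmod (w - z0))); [exact Hp|].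
    unfold Rdiv at 1. rewrite Rmult_assoc, Rinv_l; lra.
Qed.

Lemma hol_diff_quot (U : C -> Prop) (S : list C) (f : C -> C) (z0 l : C) :
  hol U S f -> Cder f z0 l -> hol U (z0 :: S) (diff_quot f z0 l).
Proof.
  intros Hf Hl z Uz. destruct (Hf z Uz) as [Hc Hd].
  destruct (excluded_middle_informative (z = z0)) as [->|Hne].
  - split; [now apply Ccont_diff_quot_at|]. intros Hn. exfalso. apply Hn. now left.
  - destruct (diff_quot_eq_local f z0 l z Hne) as [Hr E].
    assert (Hinv : Cdiff (fun w => / (w - z0))%C z).
    { apply (Cdiff_inv (fun w => w - z0)%C).
      - apply (Cdiff_minus (fun w => w) (fun _ => z0)); [apply Cdiff_id|apply Cdiff_const].
      - now apply Cminus_neq_0. }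
    split.
    + refine (Ccont_eq_local _ _ z _ Hr E _).
      apply Ccont_mult; [|now apply Cdiff_Ccont].
      intros eps He. destruct (Hc eps He) as [d [Hd0 Hw]].
      exists d. split; [exact Hd0|]. intros w Hwd.
      replace (f w - f z0 - (f z - f z0))%C with (f w - f z)%C by ring. now apply Hw.
    + intros Hn. refine (Cdiff_eq_local _ _ z _ Hr E _).
      apply Cdiff_mult; [|exact Hinv].
      apply Cdiff_minus; [|apply Cdiff_const].
      apply Hd. intros Hin. apply Hn. now right.
Qed.

(** * Goursat's theorem on rectangles *)

Lemma Cmod_le_abs (x y : R) : Cmod (x, y) <= Rabs x + Rabs y.
Proof.
  replace (x, y) with (RtoC x + Ci * RtoC y)%C.
  - eapply Rle_trans; [apply Cmod_triangle|].
    rewrite Cmod_mult, Cmod_Ci, !Cmod_R. lra.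
  - unfold RtoC, Ci, Cplus, Cmult; simpl. f_equal; ring.
Qed.

Lemma im_le_Cmod (z : C) : Rabs (Im z) <= Cmod z.
Proof. eapply Rle_trans; [apply Rmax_r|apply Rmax_Cmod]. Qed.

Lemma Re_minus (z w : C) : Re (z - w)%C = Re z - Re w.
Proof. destruct z, w; reflexivity. Qed.

Lemma Im_minus (z w : C) : Im (z - w)%C = Im z - Im w.
Proof. destruct z, w; reflexivity. Qed.

Lemma pair_minus (x y u v : R) : ((x, y) - (u, v))%C = (x - u, y - v).
Proof. reflexivity. Qed.

Lemma continuous_eps (g : R -> R) (x : R) :
  (forall eps, 0 < eps -> exists delta, 0 < delta /\
     forall t, Rabs (t - x) < delta -> Rabs (g t - g x) < eps) ->
  continuous g x.
Proof.
  intros H P [eps HP]. destruct (H eps (cond_pos eps)) as [d [Hd Hw]].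
  exists (mkposreal d Hd). intros t Ht. apply HP. apply Hw. exact Ht.
Qed.

Lemma Ccont_Re_h (f : C -> C) (x y : R) :
  Ccont f (x, y) -> continuous (fun t => Re (f (t, y))) x.
Proof.
  intros H. apply continuous_eps. intros eps He.
  destruct (H eps He) as [d [Hd Hw]]. exists d. split; [exact Hd|]. intros t Ht.
  rewrite <- Re_minus. eapply Rle_lt_trans; [apply re_le_Cmod|]. apply Hw.
  rewrite pair_minus. eapply Rle_lt_trans; [apply Cmod_le_abs|].
  rewrite Rminus_diag, Rabs_R0. lra.
Qed.

Lemma Ccont_Im_v (f : C -> C) (x y : R) :
  Ccont f (x, y) -> continuous (fun t => Im (f (x, t))) y.
Proof.
  intros H. apply continuous_eps. intros eps He.
  destruct (H eps He) as [d [Hd Hw]]. exists d. split; [exact Hd|]. intros t Ht.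
  rewrite <- Im_minus. eapply Rle_lt_trans; [apply im_le_Cmod|]. apply Hw.
  rewrite pair_minus. eapply Rle_lt_trans; [apply Cmod_le_abs|].
  rewrite Rminus_diag, Rabs_R0. lra.
Qed.

Lemma Ccont_2d (f : C -> C) (x y : R) : Ccont f (x, y) ->
  continuity_2d_pt (fun u v => Re (f (u, v))) x y /\
  continuity_2d_pt (fun u v => Im (f (u, v))) x y.
Proof.
  intros H. split; intros eps; destruct (H eps (cond_pos eps)) as [d [Hd Hw]];
  assert (Hd2 : 0 < d / 2) by lra; exists (mkposreal _ Hd2); simpl; intros u v Hu Hv;
  [rewrite <- Re_minus; eapply Rle_lt_trans; [apply re_le_Cmod|]
  |rewrite <- Im_minus; eapply Rle_lt_trans; [apply im_le_Cmod|]];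
  apply Hw; rewrite pair_minus; eapply Rle_lt_trans; try apply Cmod_le_abs; lra.
Qed.

Definition in_rect (x0 x1 y0 y1 : R) (z : C) : Prop :=
  x0 <= Re z <= x1 /\ y0 <= Im z <= y1.

(* Real part of the counterclockwise contour integral of [f]; the imaginary
   part is the same expression for [- Ci * f]. *)
Definition contour (f : C -> C) (x0 x1 y0 y1 : R) : R :=
  RInt (fun x => Re (f (x, y0)) - Re (f (x, y1))) x0 x1 -
  RInt (fun y => Im (f (x1, y)) - Im (f (x0, y))) y0 y1.

Definition cont_on (f : C -> C) (x0 x1 y0 y1 : R) : Prop :=
  forall x y, x0 <= x <= x1 -> y0 <= y <= y1 -> Ccont f (x, y).

Lemma cont_on_sub (f : C -> C) (x0 x1 y0 y1 a b c d : R) :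
  cont_on f x0 x1 y0 y1 -> x0 <= a -> b <= x1 -> y0 <= c -> d <= y1 ->
  cont_on f a b c d.
Proof. intros H ? ? ? ? x y Hx Hy. apply H; lra. Qed.

Lemma ex_RInt_h (f : C -> C) (x0 x1 y : R) : x0 <= x1 ->
  (forall x, x0 <= x <= x1 -> Ccont f (x, y)) ->
  ex_RInt (fun x => Re (f (x, y))) x0 x1.
Proof.
  intros Hx H. apply (ex_RInt_continuous (V := R_CompleteNormedModule)).
  rewrite Rmin_left, Rmax_right by exact Hx. intros z Hz. now apply Ccont_Re_h, H.
Qed.

Lemma ex_RInt_v (f : C -> C) (x y0 y1 : R) : y0 <= y1 ->
  (forall y, y0 <= y <= y1 -> Ccont f (x, y)) ->
  ex_RInt (fun y => Im (f (x, y))) y0 y1.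
Proof.
  intros Hx H. apply (ex_RInt_continuous (V := R_CompleteNormedModule)).
  rewrite Rmin_left, Rmax_right by exact Hx. intros z Hz. now apply Ccont_Im_v, H.
Qed.

Lemma contour_split_v (f : C -> C) (x0 x1 y0 y1 m : R) :
  cont_on f x0 x1 y0 y1 -> x0 <= m <= x1 -> y0 <= y1 ->
  contour f x0 x1 y0 y1 = contour f x0 m y0 y1 + contour f m x1 y0 y1.
Proof.
  intros H Hm Hy. unfold contour.
  assert (E : forall a b y, x0 <= a -> a <= b -> b <= x1 -> y0 <= y <= y1 ->
    ex_RInt (fun x => Re (f (x, y))) a b).
  { intros a b y ? ? ? ?. apply ex_RInt_h; [lra|]. intros; apply H; lra. }
  assert (V : forall x, x0 <= x <= x1 -> ex_RInt (fun y => Im (f (x, y))) y0 y1).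
  { intros x Hx. apply ex_RInt_v; [lra|]. intros; apply H; lra. }
  rewrite <- (RInt_Chasles (fun x => Re (f (x, y0)) - Re (f (x, y1))) x0 m x1).
  2, 3: apply (ex_RInt_minus (V := R_NormedModule)); apply E; lra.
  change plus with Rplus.
  rewrite !(RInt_minus (V := R_CompleteNormedModule) (fun y => Im (f (_, y))) (fun y => Im (f (_, y))))
    by (apply V; lra).
  change minus with Rminus. lra.
Qed.

Lemma contour_split_h (f : C -> C) (x0 x1 y0 y1 m : R) :
  cont_on f x0 x1 y0 y1 -> x0 <= x1 -> y0 <= m <= y1 ->
  contour f x0 x1 y0 y1 = contour f x0 x1 y0 m + contour f x0 x1 m y1.
Proof.
  intros H Hx Hm. unfold contour.
  assert (E : forall y, y0 <= y <= y1 -> ex_RInt (fun x => Re (f (x, y))) x0 x1).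
  { intros y ?. apply ex_RInt_h; [lra|]. intros; apply H; lra. }
  assert (V : forall x c d, x0 <= x <= x1 -> y0 <= c -> c <= d -> d <= y1 ->
     ex_RInt (fun y => Im (f (x, y))) c d).
  { intros x c d ? ? ? ?. apply ex_RInt_v; [lra|]. intros; apply H; lra. }
  rewrite <- (RInt_Chasles (fun y => Im (f (x1, y)) - Im (f (x0, y))) y0 m y1).
  2, 3: apply (ex_RInt_minus (V := R_NormedModule)); apply V; lra.
  change plus with Rplus.
  rewrite !(RInt_minus (V := R_CompleteNormedModule) (fun x => Re (f (x, _))) (fun x => Re (f (x, _))))
    by (apply E; lra).
  change minus with Rminus. lra.
Qed.

(** Compactness by bisection: if [P] failed, it would fail on a quarter, then on a quarter of that,
    and so on; these cells shrink to a point where the local hypothesis is violated. *)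
Lemma cell_induction (P : R -> R -> R -> R -> Prop) (x0 x1 y0 y1 : R) :
  x0 <= x1 -> y0 <= y1 ->
  (forall a b c d, x0 <= a -> a <= b -> b <= x1 -> y0 <= c -> c <= d -> d <= y1 ->
     P a ((a + b) / 2) c ((c + d) / 2) -> P ((a + b) / 2) b c ((c + d) / 2) ->
     P a ((a + b) / 2) ((c + d) / 2) d -> P ((a + b) / 2) b ((c + d) / 2) d ->
     P a b c d) ->
  (forall x y, x0 <= x <= x1 -> y0 <= y <= y1 -> exists delta, 0 < delta /\
     forall a b c d, x0 <= a <= x -> x <= b <= x1 -> y0 <= c <= y -> y <= d <= y1 ->
       b - a < delta -> d - c < delta -> P a b c d) ->
  P x0 x1 y0 y1.
Proof.
  intros Hx Hy Hsplit Hloc. apply NNPP. intros Hbad.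
  set (bad := fun q : R * R * (R * R) =>
    (x0 <= fst (fst q) /\ fst (fst q) <= snd (fst q) /\ snd (fst q) <= x1) /\
    (y0 <= fst (snd q) /\ fst (snd q) <= snd (snd q) /\ snd (snd q) <= y1) /\
    ~ P (fst (fst q)) (snd (fst q)) (fst (snd q)) (snd (snd q))).
  set (child := fun q q' : R * R * (R * R) =>
    (fst (fst q) <= fst (fst q') /\ snd (fst q') <= snd (fst q) /\
     snd (fst q') - fst (fst q') = (snd (fst q) - fst (fst q)) / 2) /\
    (fst (snd q) <= fst (snd q') /\ snd (snd q') <= snd (snd q) /\
     snd (snd q') - fst (snd q') = (snd (snd q) - fst (snd q)) / 2)).
  (* The implication stands under the existential so that [choice] yields a step function defined on
     all cells; a cell that is not bad is sent to itself. *)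
  assert (Hstep : forall q, exists q', bad q -> bad q' /\ child q q').
  { intros [[a b] [c d]]. destruct (classic (bad (a, b, (c, d)))) as [Hq|Hq].
    2:{ exists (a, b, (c, d)). tauto. }
    destruct Hq as [Ha [Hc HP]]; simpl in *.
    destruct (classic (P a ((a + b) / 2) c ((c + d) / 2))) as [P1|P1].
    2:{ exists (a, (a + b) / 2, (c, (c + d) / 2)). intros _.
        unfold bad, child; simpl; repeat split; try lra; exact P1. }
    destruct (classic (P ((a + b) / 2) b c ((c + d) / 2))) as [P2|P2].
    2:{ exists ((a + b) / 2, b, (c, (c + d) / 2)). intros _.
        unfold bad, child; simpl; repeat split; try lra; exact P2. }
    destruct (classic (P a ((a + b) / 2) ((c + d) / 2) d)) as [P3|P3].
    2:{ exists (a, (a + b) / 2, ((c + d) / 2, d)). intros _.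
        unfold bad, child; simpl; repeat split; try lra; exact P3. }
    destruct (classic (P ((a + b) / 2) b ((c + d) / 2) d)) as [P4|P4].
    2:{ exists ((a + b) / 2, b, ((c + d) / 2, d)). intros _.
        unfold bad, child; simpl; repeat split; try lra; exact P4. }
    exfalso. apply HP. apply Hsplit; tauto. }
  destruct (choice _ Hstep) as [step Hs].
  set (q := fun n => Nat.iter n step (x0, x1, (y0, y1))).
  assert (Hq : forall n, bad (q n)).
  { induction n as [|n IH]; [unfold bad; simpl; repeat split; try lra; exact Hbad|].
    exact (proj1 (Hs _ IH)). }
  assert (Hc : forall n, child (q n) (q (S n))) by (intros n; exact (proj2 (Hs _ (Hq n)))).
  assert (Hnest : forall u v : nat -> R, (forall n, u n <= u (S n)) ->
    (forall n, v (S n) <= v n) -> (forall n, u n <= v n) ->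
    (forall n, v (S n) - u (S n) = (v n - u n) / 2) ->
    exists l, (forall n, u n <= l <= v n) /\
      forall eps, 0 < eps -> exists N, forall n, (N <= n)%nat -> v n - u n < eps).
  { intros u v Hu Hv Huv Hw.
    assert (Hmono : forall m n, (m <= n)%nat -> u m <= u n /\ v n <= v m).
    { intros m n Hmn. induction Hmn as [|n Hmn IH]; [lra|].
      specialize (Hu n); specialize (Hv n); lra. }
    assert (Hcross : forall m n, u m <= v n).
    { intros m n. destruct (Hmono m (max m n)) as [A _]; [lia|].
      destruct (Hmono n (max m n)) as [_ B]; [lia|]. specialize (Huv (max m n)). lra. }
    destruct (completeness (fun x => exists n, x = u n)) as [l [Hl1 Hl2]].
    { exists (v O). intros x [n ->]. apply Hcross. }
    { exists (u O). now exists O. }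
    exists l. split.
    { intros n. split; [apply Hl1; now exists n|]. apply Hl2. intros x [m ->]. apply Hcross. }
    assert (Hpow : forall n, v n - u n = (v O - u O) * (/ 2) ^ n).
    { induction n as [|n IH]; [simpl; lra|]. rewrite Hw, IH. simpl. lra. }
    intros eps He. set (W := v O - u O + 1).
    assert (HW : 0 < W) by (unfold W; specialize (Huv O); lra).
    destruct (pow_lt_1_zero (/ 2)) with (y := eps / W) as [N HN].
    { rewrite Rabs_pos_eq; lra. }
    { now apply Rdiv_lt_0_compat. }
    exists N. intros n Hn. rewrite Hpow. specialize (HN n Hn).
    assert (Hp : 0 <= (/ 2) ^ n) by (apply pow_le; lra).
    rewrite Rabs_pos_eq in HN by exact Hp.
    apply Rle_lt_trans with (W * (/ 2) ^ n).
    - apply Rmult_le_compat_r; [exact Hp|unfold W; lra].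
    - apply Rlt_le_trans with (W * (eps / W)).
      + now apply Rmult_lt_compat_l.
      + right. field. lra. }
  destruct (Hnest (fun n => fst (fst (q n))) (fun n => snd (fst (q n)))) as [x [Hxn Hxw]];
    try (intros n; destruct (Hc n); destruct (Hq n); tauto).
  destruct (Hnest (fun n => fst (snd (q n))) (fun n => snd (snd (q n)))) as [y [Hyn Hyw]];
    try (intros n; destruct (Hc n); destruct (Hq n); tauto).
  assert (Bx := Hxn O). assert (By := Hyn O). simpl in Bx, By.
  destruct (Hloc x y Bx By) as [delta [Hd HP]].
  destruct (Hxw delta Hd) as [N1 HN1]. destruct (Hyw delta Hd) as [N2 HN2].
  set (n := max N1 N2). destruct (Hq n) as [Qa [Qc Qn]]. apply Qn.
  specialize (Hxn n). specialize (Hyn n). simpl in Hxn, Hyn.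
  apply HP; try lra; [apply HN1|apply HN2]; unfold n; lia.
Qed.

Lemma RInt_minus_const (g : R -> R) (a b k : R) : ex_RInt g a b ->
  RInt (fun u => g u - k) a b = RInt g a b - (b - a) * k.
Proof.
  intros H.
  apply is_RInt_unique.
  apply (is_RInt_minus (V := R_NormedModule) g (fun _ => k)).
  - exact (RInt_correct (V := R_CompleteNormedModule) g a b H).
  - apply (is_RInt_const (V := R_NormedModule)).
Qed.

(** The affine part of [f] contributes (b - a) (d - c) Im l to both integrals and cancels; the
    remainder is at most eps times the half-perimeter on each side. *)
Lemma contour_local_bound (f : C -> C) (l : C) (x y a b c d eps : R) :
  a <= x <= b -> c <= y <= d -> cont_on f a b c d ->
  (forall u v, a <= u <= b -> c <= v <= d ->
    Cmod (f (u, v) - f (x, y) - l * ((u, v) - (x, y))) <= eps * Cmod ((u, v) - (x, y))) ->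
  0 <= eps ->
  Rabs (contour f a b c d) <= 2 * eps * (b - a + (d - c)) ^ 2.
Proof.
  intros Hx Hy Hc Hl He.
  set (W := b - a + (d - c)).
  assert (Hr : forall u v, a <= u <= b -> c <= v <= d ->
    Cmod (f (u, v) - f (x, y) - l * ((u, v) - (x, y))) <= eps * W).
  { intros u v Hu Hv. eapply Rle_trans; [now apply Hl|].
    apply Rmult_le_compat_l; [exact He|]. rewrite pair_minus.
    eapply Rle_trans; [apply Cmod_le_abs|]. unfold W.
    apply Rplus_le_compat; apply Rabs_le; lra. }
  assert (Exh : ex_RInt (fun u => Re (f (u, c)) - Re (f (u, d))) a b).
  { apply (ex_RInt_minus (V := R_NormedModule)); apply ex_RInt_h; try lra; intros; apply Hc; lra. }
  assert (Exv : ex_RInt (fun v => Im (f (b, v)) - Im (f (a, v))) c d).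
  { apply (ex_RInt_minus (V := R_NormedModule)); apply ex_RInt_v; try lra; intros; apply Hc; lra. }
  assert (H1 : Rabs (RInt (fun u => Re (f (u, c)) - Re (f (u, d)) - Im l * (d - c)) a b)
     <= (b - a) * (2 * (eps * W))).
  { apply abs_RInt_le_const; [lra| |].
    - apply (ex_RInt_minus (V := R_NormedModule)); [exact Exh|apply ex_RInt_const].
    - intros t Ht.
      assert (A := Hr t c Ht ltac:(lra)). assert (B := Hr t d Ht ltac:(lra)).
      apply (Rle_trans _ _ _ (re_le_Cmod _)) in A.
      apply (Rle_trans _ _ _ (re_le_Cmod _)) in B.
      replace (Re (f (t, c)) - Re (f (t, d)) - Im l * (d - c)) with
       (Re (f (t, c) - f (x, y) - l * ((t, c) - (x, y)))
        - Re (f (t, d) - f (x, y) - l * ((t, d) - (x, y)))).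
      + unfold Rminus at 1. eapply Rle_trans; [apply Rabs_triang|]. rewrite Rabs_Ropp. lra.
      + rewrite !Re_minus, !pair_minus. destruct l; unfold Cmult, Re, Im; simpl. ring. }
  assert (H2 : Rabs (RInt (fun v => Im (f (b, v)) - Im (f (a, v)) - Im l * (b - a)) c d)
     <= (d - c) * (2 * (eps * W))).
  { apply abs_RInt_le_const; [lra| |].
    - apply (ex_RInt_minus (V := R_NormedModule)); [exact Exv|apply ex_RInt_const].
    - intros t Ht.
      assert (A := Hr b t ltac:(lra) Ht). assert (B := Hr a t ltac:(lra) Ht).
      apply (Rle_trans _ _ _ (im_le_Cmod _)) in A.
      apply (Rle_trans _ _ _ (im_le_Cmod _)) in B.
      replace (Im (f (b, t)) - Im (f (a, t)) - Im l * (b - a)) with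
       (Im (f (b, t) - f (x, y) - l * ((b, t) - (x, y)))
        - Im (f (a, t) - f (x, y) - l * ((a, t) - (x, y)))).
      + unfold Rminus at 1. eapply Rle_trans; [apply Rabs_triang|]. rewrite Rabs_Ropp. lra.
      + rewrite !Im_minus, !pair_minus. destruct l; unfold Cmult, Re, Im; simpl. ring. }
  rewrite (RInt_minus_const _ a b (Im l * (d - c)) Exh) in H1.
  rewrite (RInt_minus_const _ c d (Im l * (b - a)) Exv) in H2.
  unfold contour.
  match type of H1 with Rabs (?p - _) <= _ => set (p1 := p) in * end.
  match type of H2 with Rabs (?p - _) <= _ => set (p2 := p) in * end.
  replace (p1 - p2) with ((p1 - (b - a) * (Im l * (d - c))) -
    (p2 - (d - c) * (Im l * (b - a)))) by ring.
  unfold Rminus at 1. eapply Rle_trans; [apply Rabs_triang|]. rewrite Rabs_Ropp.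
  replace (2 * eps * W ^ 2) with ((b - a) * (2 * (eps * W)) + (d - c) * (2 * (eps * W)))
    by (unfold W; ring).
  lra.
Qed.

(** The bound 2 eps W^2, with W the half-perimeter, is stable under bisection: four quarters of
    half-perimeter W / 2 give 4 (W / 2)^2 = W^2. On small cells it follows from
    differentiability. *)
Lemma goursat (f : C -> C) (x0 x1 y0 y1 : R) : x0 <= x1 -> y0 <= y1 ->
  (forall x y, x0 <= x <= x1 -> y0 <= y <= y1 -> Cdiff f (x, y)) ->
  contour f x0 x1 y0 y1 = 0.
Proof.
  intros Hx Hy Hf.
  assert (Hc : cont_on f x0 x1 y0 y1) by (intros x y ? ?; apply Cdiff_Ccont; auto).
  assert (Hsmall : forall eps, 0 < eps ->
    Rabs (contour f x0 x1 y0 y1) <= 2 * eps * (x1 - x0 + (y1 - y0)) ^ 2).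
  { intros eps He.
    apply (cell_induction (fun a b c d =>
      Rabs (contour f a b c d) <= 2 * eps * (b - a + (d - c)) ^ 2)); try assumption.
    - intros a b c d ? ? ? ? ? ? Q1 Q2 Q3 Q4.
      rewrite (contour_split_h f a b c d ((c + d) / 2)); try lra.
      2:{ eapply cont_on_sub; [exact Hc|lra..]. }
      rewrite (contour_split_v f a b c ((c + d) / 2) ((a + b) / 2)); try lra.
      2:{ eapply cont_on_sub; [exact Hc|lra..]. }
      rewrite (contour_split_v f a b ((c + d) / 2) d ((a + b) / 2)); try lra.
      2:{ eapply cont_on_sub; [exact Hc|lra..]. }
      set (j1 := contour f a _ c _) in *. set (j2 := contour f _ b c _) in *.
      set (j3 := contour f a _ _ d) in *. set (j4 := contour f _ b _ d) in *.
      assert (T1 := Rabs_triang (j1 + j2) (j3 + j4)).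
      assert (T2 := Rabs_triang j1 j2). assert (T3 := Rabs_triang j3 j4).
      replace (2 * eps * (b - a + (d - c)) ^ 2) with
        (4 * (2 * eps * ((b - a) / 2 + (d - c) / 2) ^ 2)) by field.
      replace ((a + b) / 2 - a + ((c + d) / 2 - c)) with ((b - a) / 2 + (d - c) / 2) in Q1 by field.
      replace (b - (a + b) / 2 + ((c + d) / 2 - c)) with ((b - a) / 2 + (d - c) / 2) in Q2 by field.
      replace ((a + b) / 2 - a + (d - (c + d) / 2)) with ((b - a) / 2 + (d - c) / 2) in Q3 by field.
      replace (b - (a + b) / 2 + (d - (c + d) / 2)) with ((b - a) / 2 + (d - c) / 2) in Q4 by field.
      lra.
    - intros x y Hxx Hyy. destruct (Hf x y Hxx Hyy) as [l Hl].
      destruct (Hl eps He) as [d0 [Hd0 Hw]]. exists (d0 / 2). split; [lra|].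
      intros a b c d ? ? ? ? ? ?.
      apply (contour_local_bound f l x y); try lra.
      + eapply cont_on_sub; [exact Hc|lra..].
      + intros u v Hu Hv. apply Hw. rewrite pair_minus.
        eapply Rle_lt_trans; [apply Cmod_le_abs|].
        assert (Rabs (u - x) <= b - a) by (apply Rabs_le; lra).
        assert (Rabs (v - y) <= d - c) by (apply Rabs_le; lra). lra. }
  apply NNPP. intros Hne. apply Rabs_pos_lt in Hne.
  set (B := 2 * (x1 - x0 + (y1 - y0)) ^ 2 + 1).
  assert (HB : 0 < B).
  { unfold B. assert (Hp := pow2_ge_0 (x1 - x0 + (y1 - y0))). lra. }
  set (A := Rabs (contour f x0 x1 y0 y1)) in *.
  assert (Heps : 0 < A / B) by now apply Rdiv_lt_0_compat.
  specialize (Hsmall (A / B) Heps).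
  assert (E : A = A / B * B) by (field; lra).
  replace (2 * (A / B) * (x1 - x0 + (y1 - y0)) ^ 2) with (A / B * (B - 1)) in Hsmall
    by (unfold B; ring).
  nra.
Qed.

(** In a flat rectangle the two long sides nearly cancel by uniform continuity, and the short sides
    contribute at most their length times a bound of [f]. This lets a side where only continuity is
    known be cut off at no cost. *)
Lemma contour_thin (f : C -> C) (x0 x1 y0 y1 eps : R) : x0 <= x1 -> y0 <= y1 ->
  cont_on f x0 x1 y0 y1 -> 0 < eps ->
  exists delta, 0 < delta /\ forall c d, y0 <= c -> c <= d -> d <= y1 ->
    d - c < delta -> Rabs (contour f x0 x1 c d) <= eps.
Proof.
  intros Hx Hy Hc He.
  destruct (uniform_continuity_2d (fun u v => Re (f (u, v))) x0 x1 y0 y1) with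
    (eps := mkposreal (eps / (2 * (x1 - x0 + 1))) ltac:(apply Rdiv_lt_0_compat; lra))
    as [d1 Hd1].
  { intros x y ? ?. apply Ccont_2d. now apply Hc. }
  simpl in Hd1.
  destruct (bounded_continuity (K := R_AbsRing) (V := R_NormedModule)
    (fun y => Im (f (x1, y)) - Im (f (x0, y))) y0 y1) as [M HM].
  { intros y Hyy.
    apply (continuous_minus (K := R_AbsRing) (V := R_NormedModule)
      (fun y => Im (f (x1, y))) (fun y => Im (f (x0, y)))); apply Ccont_Im_v, Hc; lra. }
  assert (HM0 : 0 < M).
  { eapply Rle_lt_trans; [apply (norm_ge_0 (V := R_NormedModule))|apply (HM y0)]; lra. }
  exists (Rmin d1 (eps / (2 * M))). split.
  { apply Rmin_pos; [apply cond_pos|apply Rdiv_lt_0_compat; lra]. }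
  intros c d Hc0 Hcd0 Hd0 Hcd.
  assert (Hcd1 := Rlt_le_trans _ _ _ Hcd (Rmin_l _ _)).
  assert (Hcd2 := Rlt_le_trans _ _ _ Hcd (Rmin_r _ _)).
  assert (H1 : Rabs (RInt (fun u => Re (f (u, c)) - Re (f (u, d))) x0 x1)
     <= (x1 - x0) * (eps / (2 * (x1 - x0 + 1)))).
  { apply abs_RInt_le_const; [lra| |].
    - apply (ex_RInt_minus (V := R_NormedModule)); apply ex_RInt_h; try lra; intros; apply Hc; lra.
    - intros t Ht. left. apply Hd1; try lra.
      + rewrite Rminus_diag, Rabs_R0. apply cond_pos.
      + rewrite Rabs_left1; lra. }
  assert (H2 : Rabs (RInt (fun v => Im (f (x1, v)) - Im (f (x0, v))) c d) <= (d - c) * M).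
  { apply abs_RInt_le_const; [lra| |].
    - apply (ex_RInt_minus (V := R_NormedModule)); apply ex_RInt_v; try lra; intros; apply Hc; lra.
    - intros t Ht. left. apply HM; lra. }
  unfold contour. unfold Rminus at 1. eapply Rle_trans; [apply Rabs_triang|]. rewrite Rabs_Ropp.
  assert (H3 : (d - c) * M <= eps / (2 * M) * M) by (apply Rmult_le_compat_r; lra).
  replace (eps / (2 * M) * M) with (eps / 2) in H3 by (field; lra).
  assert (H4 : (x1 - x0) * (eps / (2 * (x1 - x0 + 1))) <= (x1 - x0 + 1) * (eps / (2 * (x1 - x0 + 1)))).
  { apply Rmult_le_compat_r; [|lra]. left; apply Rdiv_lt_0_compat; lra. }
  replace ((x1 - x0 + 1) * (eps / (2 * (x1 - x0 + 1)))) with (eps / 2) in H4 by (field; lra).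
  lra.
Qed.

Lemma goursat_open (f : C -> C) (x0 x1 y0 y1 : R) : x0 <= x1 -> y0 <= y1 ->
  cont_on f x0 x1 y0 y1 ->
  (forall x y, x0 <= x <= x1 -> y0 < y < y1 -> Cdiff f (x, y)) ->
  contour f x0 x1 y0 y1 = 0.
Proof.
  intros Hx Hy Hc Hf. apply NNPP. intros Hne. apply Rabs_pos_lt in Hne.
  set (A := Rabs (contour f x0 x1 y0 y1)) in *.
  destruct (contour_thin f x0 x1 y0 y1 (A / 3) Hx Hy Hc) as [d [Hd Hthin]]; [lra|].
  destruct (Rlt_le_dec (y1 - y0) d) as [Hs|Hs].
  { specialize (Hthin y0 y1 ltac:(lra) ltac:(lra) ltac:(lra) Hs). fold A in Hthin. lra. }
  assert (T1 := Hthin y0 (y0 + d / 3) ltac:(lra) ltac:(lra) ltac:(lra) ltac:(lra)).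
  assert (T2 := Hthin (y1 - d / 3) y1 ltac:(lra) ltac:(lra) ltac:(lra) ltac:(lra)).
  assert (T3 : contour f x0 x1 (y0 + d / 3) (y1 - d / 3) = 0).
  { apply goursat; try lra. intros x y ? ?. apply Hf; lra. }
  assert (E1 := contour_split_h f x0 x1 y0 y1 (y0 + d / 3) Hc Hx ltac:(lra)).
  assert (E2 := contour_split_h f x0 x1 (y0 + d / 3) y1 (y1 - d / 3)
    (cont_on_sub f x0 x1 y0 y1 x0 x1 (y0 + d / 3) y1 Hc ltac:(lra) ltac:(lra) ltac:(lra) ltac:(lra))
    Hx ltac:(lra)).
  rewrite T3, Rplus_0_l in E2. rewrite E2 in E1. unfold A in *. rewrite E1 in *.
  match type of T1 with Rabs ?u <= _ => match type of T2 with Rabs ?v <= _ =>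
    assert (T := Rabs_triang u v) end end.
  lra.
Qed.

(** Cutting the rectangle along the horizontal lines through the exceptional points moves these
    points to the boundary, where continuity suffices. *)
Lemma goursat_heights (f : C -> C) (H : list R) : forall x0 x1 y0 y1,
  x0 <= x1 -> y0 <= y1 -> cont_on f x0 x1 y0 y1 ->
  (forall x y, x0 <= x <= x1 -> y0 < y < y1 -> ~ In y H -> Cdiff f (x, y)) ->
  contour f x0 x1 y0 y1 = 0.
Proof.
  induction H as [|h H IH]; intros x0 x1 y0 y1 Hx Hy Hc Hf.
  - apply goursat_open; auto.
  - destruct (classic (y0 < h < y1)) as [Hh|Hh].
    + rewrite (contour_split_h f x0 x1 y0 y1 h); try lra; try assumption.
      rewrite (IH x0 x1 y0 h), (IH x0 x1 h y1); try lra;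
        try (eapply cont_on_sub; [exact Hc|lra..]);
        intros x y ? ? Hn; apply Hf; try lra; intros [E|E]; try lra; contradiction.
    + apply IH; auto. intros x y ? ? Hn. apply Hf; auto.
      intros [<-|E]; [now apply Hh|contradiction].
Qed.

Lemma hol_contour (f : C -> C) (S : list C) (x0 x1 y0 y1 : R) : x0 <= x1 -> y0 <= y1 ->
  hol (in_rect x0 x1 y0 y1) S f -> contour f x0 x1 y0 y1 = 0.
Proof.
  intros Hx Hy Hf. apply (goursat_heights f (map Im S)); auto.
  - intros x y ? ?. apply Hf. split; simpl; lra.
  - intros x y ? ? Hn. apply Hf; [split; simpl; lra|].
    intros Hin. apply Hn. apply (in_map Im) in Hin. exact Hin.
Qed.

(** * The maximum modulus principle on rectangles *)

Definition side_bound (f : C -> C) (x0 x1 y0 y1 M : R) : Prop :=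
  (forall x, x0 <= x <= x1 -> Cmod (f (x, y0)) <= M /\ Cmod (f (x, y1)) <= M) /\
  (forall y, y0 <= y <= y1 -> Cmod (f (x0, y)) <= M /\ Cmod (f (x1, y)) <= M).

Lemma Re_scal (r : R) (z : C) : Re (RtoC r * z)%C = r * Re z.
Proof. destruct z; unfold RtoC, Cmult, Re; simpl. ring. Qed.

(** Here [e] is the tangent direction of a side and [h] is z - z0. The factor conj f0 turns the
    f0-term of the quotient into |f0|^2 Re (e i / h), whose sign is the same on all four sides; the
    bound - d / D^2 stands in for the exact contour integral of 1 / h. *)
Lemma kernel_bound (f0 fz e h : C) (M d D : R) :
  Cmod e = 1 -> Cmod fz <= M -> 0 < d -> d <= Cmod h ->
  Re (e * Ci / h)%C <= - (d / D ^ 2) ->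
  Re (e * (- Ci * Cconj f0 * ((fz - f0) / h)))%C
    <= Cmod f0 * (M / d) - Cmod f0 ^ 2 * (d / D ^ 2).
Proof.
  intros He HM Hd Hh Hk.
  assert (Hh0 : h <> 0) by (apply Cmod_gt_0; lra).
  replace (e * (- Ci * Cconj f0 * ((fz - f0) / h)))%C
    with (- (e * Ci * Cconj f0 * fz / h) + RtoC (Cmod f0 ^ 2) * (e * Ci / h))%C.
  2:{ rewrite Cmod2_conj. field. exact Hh0. }
  assert (Hre : forall u v : C, Re (u + v)%C = Re u + Re v) by (intros [] []; reflexivity).
  rewrite Hre, Re_scal.
  assert (A : Re (- (e * Ci * Cconj f0 * fz / h))%C <= Cmod f0 * (M / d)).
  { eapply Rle_trans; [apply Rle_abs|]. eapply Rle_trans; [apply re_le_Cmod|].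
    rewrite Cmod_opp, Cmod_div, !Cmod_mult, He, Cmod_Ci, Cmod_conj by exact Hh0.
    rewrite !Rmult_1_l. unfold Rdiv. rewrite Rmult_assoc.
    apply Rmult_le_compat_l; [apply Cmod_ge_0|].
    apply Rmult_le_compat; [apply Cmod_ge_0| |exact HM|].
    - left. apply Rinv_0_lt_compat. lra.
    - apply Rinv_le_contravar; lra. }
  assert (B := Rmult_le_compat_l (Cmod f0 ^ 2) _ _ (pow2_ge_0 _) Hk).
  lra.
Qed.

Lemma RInt_const_R (a b k : R) : RInt (fun _ => k) a b = (b - a) * k.
Proof. exact (RInt_const (V := R_CompleteNormedModule) a b k). Qed.

(** The contour integral of the rotated difference quotient [Q] is 0, while its integrand is at most
    [B] on every side, so [B] is nonnegative; this is the claim. [K] is chosen before [f] so that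
    one constant serves all powers of a function. *)
Lemma cauchy_bound (x0 x1 y0 y1 : R) (z0 : C) :
  x0 < Re z0 < x1 -> y0 < Im z0 < y1 ->
  exists K, forall (f : C -> C) (S : list C) (M : R),
    hol (in_rect x0 x1 y0 y1) S f -> ~ In z0 S ->
    side_bound f x0 x1 y0 y1 M -> Cmod (f z0) <= K * M.
Proof.
  destruct z0 as [p q]; simpl. intros Hp Hq.
  set (d := Rmin (Rmin (p - x0) (x1 - p)) (Rmin (q - y0) (y1 - q))).
  set (D := x1 - x0 + (y1 - y0)).
  assert (Hd : 0 < d) by (unfold d; repeat apply Rmin_pos; lra).
  assert (Hd1 : d <= p - x0) by (unfold d; eapply Rle_trans; [apply Rmin_l|apply Rmin_l]).
  assert (Hd2 : d <= x1 - p) by (unfold d; eapply Rle_trans; [apply Rmin_l|apply Rmin_r]).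
  assert (Hd3 : d <= q - y0) by (unfold d; eapply Rle_trans; [apply Rmin_r|apply Rmin_l]).
  assert (Hd4 : d <= y1 - q) by (unfold d; eapply Rle_trans; [apply Rmin_r|apply Rmin_r]).
  clearbody d.
  assert (HD : 0 < D) by (unfold D; lra).
  exists (D ^ 2 / d ^ 2). intros f S M Hf HS [Mh Mv].
  set (f0 := f (p, q)).
  assert (Hz : in_rect x0 x1 y0 y1 (p, q)) by (split; simpl; lra).
  destruct (proj2 (Hf _ Hz) HS) as [l Hl].
  set (Q := fun z => (- Ci * Cconj f0 * diff_quot f (p, q) l z)%C).
  assert (HQ : hol (in_rect x0 x1 y0 y1) ((p, q) :: S) Q).
  { intros z Uz. destruct (hol_diff_quot _ _ _ _ _ Hf Hl z Uz) as [H1 H2]. split.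
    - apply (Ccont_mult (fun _ => (- Ci * Cconj f0)%C)); [apply Ccont_const|exact H1].
    - intros Hn. apply (Cdiff_mult (fun _ => (- Ci * Cconj f0)%C)); [apply Cdiff_const|auto]. }
  assert (H0 := hol_contour Q _ x0 x1 y0 y1 ltac:(lra) ltac:(lra) HQ).
  assert (HQc : cont_on Q x0 x1 y0 y1).
  { intros x y ? ?. apply HQ. split; simpl; lra. }
  set (B := Cmod f0 * (M / d) - Cmod f0 ^ 2 * (d / D ^ 2)).
  assert (Hker : forall (x y : R) (e : C), x0 <= x <= x1 -> y0 <= y <= y1 ->
    Cmod (f (x, y)) <= M -> Cmod e = 1 ->
    (d <= Rabs (x - p) \/ d <= Rabs (y - q)) ->
    (exists k, Re (e * Ci / ((x, y) - (p, q)))%C = - k / ((x - p) ^ 2 + (y - q) ^ 2) /\ d <= k) ->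
    Re (e * Q (x, y))%C <= B).
  { intros x y e Hx Hy HM He Hdist [k [Ek Hk]].
    assert (Hh : d <= Cmod ((x, y) - (p, q))).
    { rewrite pair_minus. destruct Hdist as [Hdist|Hdist]; eapply Rle_trans; try exact Hdist.
      - apply (re_le_Cmod (x - p, y - q)).
      - apply (im_le_Cmod (x - p, y - q)). }
    assert (Hne : (x, y) <> (p, q)).
    { intros E. rewrite E in Hh. replace ((p, q) - (p, q))%C with (RtoC 0) in Hh by ring.
      rewrite Cmod_0 in Hh. lra. }
    unfold Q. rewrite diff_quot_neq by exact Hne.
    apply kernel_bound; auto. rewrite Ek.
    assert (Hpos : 0 < (x - p) ^ 2 + (y - q) ^ 2).
    { assert (A1 := pow2_ge_0 (x - p)). assert (A2 := pow2_ge_0 (y - q)).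
      destruct (Rle_lt_or_eq_dec 0 ((x - p) ^ 2 + (y - q) ^ 2)) as [E|E]; [lra|exact E|].
      exfalso. apply Hne. f_equal; nra. }
    assert (Hle : (x - p) ^ 2 + (y - q) ^ 2 <= D ^ 2).
    { assert (A1 : Rabs (x - p) <= x1 - x0) by (apply Rabs_le; lra).
      assert (A2 : Rabs (y - q) <= y1 - y0) by (apply Rabs_le; lra).
      rewrite <- (pow2_abs (x - p)), <- (pow2_abs (y - q)). unfold D.
      assert (A3 := Rabs_pos (x - p)). assert (A4 := Rabs_pos (y - q)). nra. }
    unfold Rdiv at 1. rewrite <- Ropp_mult_distr_l. apply Ropp_le_contravar.
    apply Rmult_le_compat; [lra| |exact Hk|].
    - left. apply Rinv_0_lt_compat. lra.
    - now apply Rinv_le_contravar. }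
  assert (Hinv : forall u v : R, (/ (u, v))%C = (u / (u ^ 2 + v ^ 2), - v / (u ^ 2 + v ^ 2)))
    by reflexivity.
  assert (C1 : Cmod (RtoC 1) = 1) by apply Cmod_1.
  assert (C2 : Cmod (- RtoC 1) = 1) by (rewrite Cmod_opp; apply Cmod_1).
  assert (C3 : Cmod Ci = 1) by apply Cmod_Ci.
  assert (C4 : Cmod (- Ci) = 1) by (rewrite Cmod_opp; apply Cmod_Ci).
  assert (Hbot : forall x, x0 <= x <= x1 -> Re (Q (x, y0)) <= B).
  { intros x Hx. replace (Q (x, y0)) with (1 * Q (x, y0))%C by ring.
    apply Hker; try lra; [now apply Mh|right; rewrite Rabs_left1; lra|].
    exists (q - y0). split; [|lra].
    unfold Cdiv. rewrite pair_minus, Hinv. unfold Ci, RtoC, Cmult, Re; simpl. unfold Rdiv. ring. }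
  assert (Htop : forall x, x0 <= x <= x1 -> - Re (Q (x, y1)) <= B).
  { intros x Hx. replace (- Re (Q (x, y1))) with (Re (- (1) * Q (x, y1))%C).
    2:{ destruct (Q (x, y1)); unfold Copp, RtoC, Cmult, Re; simpl; ring. }
    apply Hker; try lra; [now apply Mh|right; rewrite Rabs_pos_eq; lra|].
    exists (y1 - q). split; [|lra].
    unfold Cdiv. rewrite pair_minus, Hinv. unfold Ci, RtoC, Copp, Cmult, Re; simpl. unfold Rdiv. ring. }
  assert (Hright : forall y, y0 <= y <= y1 -> - Im (Q (x1, y)) <= B).
  { intros y Hy. replace (- Im (Q (x1, y))) with (Re (Ci * Q (x1, y))%C).
    2:{ destruct (Q (x1, y)); unfold Ci, Cmult, Re, Im; simpl; ring. }
    apply Hker; try lra; [now apply Mv|left; rewrite Rabs_pos_eq; lra|].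
    exists (x1 - p). split; [|lra].
    unfold Cdiv. rewrite pair_minus, Hinv. unfold Ci, RtoC, Copp, Cmult, Re; simpl. unfold Rdiv. ring. }
  assert (Hleft : forall y, y0 <= y <= y1 -> Im (Q (x0, y)) <= B).
  { intros y Hy. replace (Im (Q (x0, y))) with (Re (- Ci * Q (x0, y))%C).
    2:{ destruct (Q (x0, y)); unfold Ci, Copp, Cmult, Re, Im; simpl; ring. }
    apply Hker; try lra; [now apply Mv|left; rewrite Rabs_left1; lra|].
    exists (p - x0). split; [|lra].
    unfold Cdiv. rewrite pair_minus, Hinv. unfold Ci, RtoC, Copp, Cmult, Re; simpl. unfold Rdiv. ring. }
  unfold contour in H0.
  assert (I1 : RInt (fun x => Re (Q (x, y0)) - Re (Q (x, y1))) x0 x1 <= (x1 - x0) * (2 * B)).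
  { rewrite <- (RInt_const_R x0 x1 (2 * B)).
    apply RInt_le; [lra| |apply ex_RInt_const|].
    - apply (ex_RInt_minus (V := R_NormedModule)); apply ex_RInt_h; try lra; intros; apply HQc; lra.
    - intros x Hx. specialize (Hbot x ltac:(lra)). specialize (Htop x ltac:(lra)). lra. }
  assert (I2 : (y1 - y0) * (- (2 * B)) <= RInt (fun y => Im (Q (x1, y)) - Im (Q (x0, y))) y0 y1).
  { rewrite <- (RInt_const_R y0 y1 (- (2 * B))).
    apply RInt_le; [lra|apply ex_RInt_const| |].
    - apply (ex_RInt_minus (V := R_NormedModule)); apply ex_RInt_v; try lra; intros; apply HQc; lra.
    - intros y Hy. specialize (Hright y ltac:(lra)). specialize (Hleft y ltac:(lra)). lra. }
  (* The contour integral is at most 2 D B, with D the half-perimeter. *)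
  assert (HB : 0 <= B).
  { apply Rnot_lt_le. intros HB. assert (X : D * B < 0) by nra. unfold D in X. nra. }
  assert (HM : 0 <= M).
  { eapply Rle_trans; [apply Cmod_ge_0|apply (Mh x0)]; lra. }
  fold f0. destruct (Cmod_ge_0 f0) as [Hf0|Hf0].
  2:{ rewrite <- Hf0. apply Rmult_le_pos; [|exact HM].
      left. apply Rdiv_lt_0_compat; apply pow_lt; lra. }
  assert (HB' : Cmod f0 * (d / D ^ 2) <= M / d).
  { apply (Rmult_le_reg_l (Cmod f0)); [exact Hf0|]. unfold B in HB. lra. }
  apply (Rmult_le_reg_r (d / D ^ 2)).
  { apply Rdiv_lt_0_compat; [lra|apply pow_lt; lra]. }
  eapply Rle_trans; [exact HB'|]. right. field. split; lra.
Qed.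

Lemma le_of_pow_le (x K M : R) : 0 <= M -> (forall n : nat, x ^ n <= K * M ^ n) -> x <= M.
Proof.
  intros HM H. apply Rnot_lt_le. intros Hlt.
  destruct HM as [HM|<-].
  2:{ specialize (H 1%nat). simpl in H. lra. }
  destruct (Pow_x_infinity (x / M)) with (b := K + 1) as [N HN].
  { assert (1 < x / M).
    { apply (Rmult_lt_reg_r M); [lra|]. unfold Rdiv. rewrite Rmult_assoc, Rinv_l; lra. }
    rewrite Rabs_pos_eq; lra. }
  specialize (HN N (Nat.le_refl N)).
  assert (Hx : 0 < x / M) by (apply Rdiv_lt_0_compat; lra).
  rewrite Rabs_pos_eq in HN by (apply pow_le; lra).
  specialize (H N).
  assert (E : x ^ N = (x / M) ^ N * M ^ N).
  { rewrite <- Rpow_mult_distr. f_equal. field. lra. }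
  assert (HMN : 0 < M ^ N) by now apply pow_lt.
  rewrite E in H. apply Rmult_le_reg_r in H; [lra|exact HMN].
Qed.

(* Cauchy's formula only gives a bound up to a constant depending on [z0] and
   the rectangle; applied to [f ^ n] the constant disappears as n -> oo. *)
Lemma max_modulus (f : C -> C) (S : list C) (x0 x1 y0 y1 M : R) (z0 : C) :
  x0 < Re z0 < x1 -> y0 < Im z0 < y1 ->
  hol (in_rect x0 x1 y0 y1) S f -> ~ In z0 S ->
  side_bound f x0 x1 y0 y1 M -> Cmod (f z0) <= M.
Proof.
  intros Hx Hy Hf HS HM. destruct (cauchy_bound x0 x1 y0 y1 z0 Hx Hy) as [K HK].
  apply (le_of_pow_le _ K).
  { destruct HM as [Mh _]. eapply Rle_trans; [apply Cmod_ge_0|apply (proj1 (Mh x0 ltac:(lra)))]. }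
  intros n. rewrite <- Cmod_pow. apply (HK (fun z => f z ^ n)%C S); auto.
  - intros z Uz. destruct (Hf z Uz) as [H1 H2]. split.
    + now apply Ccont_pow.
    + intros Hn. now apply Cdiff_pow, H2.
  - destruct HM as [Mh Mv].
    split; intros t Ht; split; rewrite Cmod_pow; apply pow_incr;
      (split; [apply Cmod_ge_0|]); [apply Mh|apply Mh|apply Mv|apply Mv]; exact Ht.
Qed.

(** * Many zeros in a small disc make a function small *)

Definition zero_prod (l : list C) (z : C) : C :=
  fold_right (fun lam p => (z - lam) * p)%C (RtoC 1) l.

Lemma zero_prod_le (l : list C) (z : C) (A : R) : 0 <= A ->
  (forall lam, In lam l -> Cmod (z - lam) <= A) -> Cmod (zero_prod l z) <= A ^ length l.
Proof.
  intros HA. induction l as [|lam l IH]; intros H; simpl.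
  - rewrite Cmod_1. lra.
  - rewrite Cmod_mult. apply Rmult_le_compat; try apply Cmod_ge_0.
    + apply H; now left.
    + apply IH. intros; apply H; now right.
Qed.

Lemma zero_prod_ge (l : list C) (z : C) (A : R) : 0 <= A ->
  (forall lam, In lam l -> A <= Cmod (z - lam)) -> A ^ length l <= Cmod (zero_prod l z).
Proof.
  intros HA. induction l as [|lam l IH]; intros H; simpl.
  - rewrite Cmod_1. lra.
  - rewrite Cmod_mult. apply Rmult_le_compat; auto using pow_le.
    + apply H; now left.
    + apply IH. intros; apply H; now right.
Qed.

Lemma zero_prod_neq_0 (l : list C) (z : C) : ~ In z l -> zero_prod l z <> 0.
Proof.
  induction l as [|lam l IH]; simpl; intros H.
  - intros E. injection E. lra.
  - apply Cmult_neq_0; [apply Cminus_neq_0; intros ->; tauto|apply IH; tauto].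
Qed.

(** Since the zeros are distinct, the quotient by the others is differentiable at the next one, and
    it vanishes there because the other factors do not. *)
Lemma divide_zeros (f : C -> C) (l : list C) : (forall z, Cdiff f z) -> NoDup l ->
  (forall lam, In lam l -> f lam = 0) ->
  exists g, hol (fun _ => True) l g /\ forall z, f z = (g z * zero_prod l z)%C.
Proof.
  intros Hf Hnd H0. induction Hnd as [|lam l Hlam Hnd IH].
  - exists f. split.
    + intros z _. split; [now apply Cdiff_Ccont|auto].
    + intros z. simpl. ring.
  - destruct IH as [g [Hg Eg]]; [intros; apply H0; now right|].
    destruct (proj2 (Hg lam I) Hlam) as [m Hm].
    exists (diff_quot g lam m). split; [now apply hol_diff_quot|].
    assert (Hglam : g lam = 0).
    { assert (E := H0 lam (or_introl eq_refl)). rewrite Eg in E.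
      apply NNPP. intros Hn. now apply (Cmult_neq_0 _ _ Hn (zero_prod_neq_0 l lam Hlam)). }
    intros z. rewrite Eg. simpl.
    destruct (classic (z = lam)) as [->|Hne].
    + rewrite Hglam. ring.
    + rewrite diff_quot_neq, Hglam by exact Hne. field. now apply Cminus_neq_0.
Qed.

(** On the boundary of the square each factor z - lam has modulus at least s - h, at [z0] at most r
    + h. The maximum principle for the quotient thus gains (r + h) / (s - h) per zero. *)
Lemma many_zeros_small (f : C -> C) (l : list C) (c z0 : C) (s h r M : R) :
  (forall z, Cdiff f z) -> NoDup l ->
  (forall lam, In lam l -> f lam = 0 /\ Cmod (lam - c) <= h) ->
  0 <= h < s -> 0 <= r -> Cmod (z0 - c) <= r ->
  Re c - s < Re z0 < Re c + s -> Im c - s < Im z0 < Im c + s ->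
  side_bound f (Re c - s) (Re c + s) (Im c - s) (Im c + s) M ->
  Cmod (f z0) <= M * ((r + h) / (s - h)) ^ length l.
Proof.
  intros Hf Hnd Hl Hh Hr Hz Hx Hy [Mh Mv].
  assert (HM : 0 <= M).
  { eapply Rle_trans; [apply Cmod_ge_0|apply (Mh (Re z0))]; lra. }
  (* [max_modulus] does not apply at an exceptional point, but there f itself vanishes. *)
  destruct (classic (In z0 l)) as [Hin|Hin].
  { rewrite (proj1 (Hl _ Hin)), Cmod_0. apply Rmult_le_pos; [exact HM|].
    apply pow_le. apply Rmult_le_pos; [lra|]. left. apply Rinv_0_lt_compat. lra. }
  destruct (divide_zeros f l Hf Hnd) as [g [Hg Eg]]; [intros; now apply Hl|].
  set (n := length l).
  assert (Hpos : 0 < (s - h) ^ n) by (apply pow_lt; lra).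
  assert (Hgb : forall z, s <= Cmod (z - c) -> Cmod (f z) <= M -> Cmod (g z) <= M / (s - h) ^ n).
  { intros z Hzc HMz. rewrite Eg, Cmod_mult in HMz.
    assert (Hp : (s - h) ^ n <= Cmod (zero_prod l z)).
    { apply zero_prod_ge; [lra|]. intros lam Hlam. destruct (Hl lam Hlam) as [_ Hlc].
      assert (T := Cmod_triangle_inv (z - c) (lam - c)).
      replace (z - c - (lam - c))%C with (z - lam)%C in T by ring. lra. }
    apply (Rmult_le_reg_r ((s - h) ^ n)); [exact Hpos|].
    unfold Rdiv. rewrite Rmult_assoc, Rinv_l, Rmult_1_r by lra.
    eapply Rle_trans; [|exact HMz]. apply Rmult_le_compat_l; [apply Cmod_ge_0|exact Hp]. }
  assert (Hgz : Cmod (g z0) <= M / (s - h) ^ n).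
  { apply (max_modulus g l (Re c - s) (Re c + s) (Im c - s) (Im c + s)); auto.
    - intros z _. exact (Hg z I).
    - assert (Hre : forall x y, s <= Rabs (x - Re c) \/ s <= Rabs (y - Im c) ->
        s <= Cmod ((x, y) - c)).
      { destruct c as [u v]; simpl. intros x y H. rewrite pair_minus.
        destruct H as [H|H]; eapply Rle_trans; try exact H.
        - apply (re_le_Cmod (x - u, y - v)).
        - apply (im_le_Cmod (x - u, y - v)). }
      split; intros t Ht; split; apply Hgb.
      + apply Hre; right; rewrite Rabs_left1; lra.
      + now apply Mh.
      + apply Hre; right; rewrite Rabs_pos_eq; lra.
      + now apply Mh.
      + apply Hre; left; rewrite Rabs_left1; lra.
      + now apply Mv.
      + apply Hre; left; rewrite Rabs_pos_eq; lra.
      + now apply Mv. }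
  rewrite Eg, Cmod_mult.
  apply Rle_trans with (M / (s - h) ^ n * (r + h) ^ n).
  - apply Rmult_le_compat; try apply Cmod_ge_0; [exact Hgz|].
    apply zero_prod_le; [lra|]. intros lam Hlam. destruct (Hl lam Hlam) as [_ Hlc].
    replace (z0 - lam)%C with ((z0 - c) - (lam - c))%C by ring.
    eapply Rle_trans; [apply Cmod_minus_triangle|]. lra.
  - unfold Rdiv. rewrite Rpow_mult_distr, pow_inv. right. ring.
Qed.

(** * The complex exponential *)

Definition cexp (z : C) : C := (exp (Re z) * cos (Im z), exp (Re z) * sin (Im z)).

Lemma Cmod_cexp (z : C) : Cmod (cexp z) = exp (Re z).
Proof.
  unfold cexp, Cmod; simpl fst; simpl snd.
  replace ((exp (Re z) * cos (Im z)) ^ 2 + (exp (Re z) * sin (Im z)) ^ 2)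
    with (Rsqr (exp (Re z)) * (Rsqr (sin (Im z)) + Rsqr (cos (Im z)))) by (unfold Rsqr; ring).
  rewrite sin2_cos2, Rmult_1_r. apply sqrt_Rsqr. left; apply exp_pos.
Qed.

Lemma cexp_plus (z w : C) : cexp (z + w) = (cexp z * cexp w)%C.
Proof.
  destruct z as [x y], w as [u v]. unfold cexp, Cplus, Cmult; simpl.
  rewrite exp_plus, cos_plus, sin_plus. f_equal; ring.
Qed.

Lemma derivable_pt_lim_linear (g : R -> R) (l eps : R) : derivable_pt_lim g 0 l -> 0 < eps ->
  exists delta, 0 < delta /\ forall h, Rabs h < delta -> Rabs (g h - g 0 - l * h) <= eps * Rabs h.
Proof.
  intros H He. destruct (H eps He) as [d Hd]. exists d. split; [apply cond_pos|]. intros h Hh.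
  destruct (Req_dec h 0) as [->|Hne].
  - replace (g 0 - g 0 - l * 0) with 0 by ring. rewrite Rabs_R0. lra.
  - specialize (Hd h Hne Hh). rewrite Rplus_0_l in Hd.
    replace (g h - g 0 - l * h) with (((g h - g 0) / h - l) * h) by (field; exact Hne).
    rewrite Rabs_mult. apply Rmult_le_compat_r; [apply Rabs_pos|lra].
Qed.

Lemma cexp_near_0 (eps : R) : 0 < eps -> exists delta, 0 < delta /\
  forall h, Cmod h < delta -> Cmod (cexp h - 1 - h) <= eps * Cmod h.
Proof.
  (* The errors [Y1], [Y2], [Y4] add up to 5 e D, at most half of eps D; the radius eps / 4 makes
     [Y3] the other half. *)
  intros He. set (e := Rmin 1 (eps / 10)).
  assert (He1 : 0 < e) by (unfold e; apply Rmin_pos; lra).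
  assert (He2 : e <= 1) by apply Rmin_l. assert (He3 : e <= eps / 10) by apply Rmin_r.
  destruct (derivable_pt_lim_linear exp _ e (derivable_pt_lim_exp 0) He1) as [d1 [Hd1 H1]].
  destruct (derivable_pt_lim_linear sin _ e (derivable_pt_lim_sin 0) He1) as [d2 [Hd2 H2]].
  destruct (derivable_pt_lim_linear cos _ e (derivable_pt_lim_cos 0) He1) as [d3 [Hd3 H3]].
  exists (Rmin (Rmin d1 d2) (Rmin d3 (Rmin (1 / 2) (eps / 4)))).
  split; [repeat apply Rmin_pos; lra|].
  intros [x y] Hh.
  assert (Ha := Rlt_le_trans _ _ _ Hh (Rmin_l _ _)).
  assert (Hb := Rlt_le_trans _ _ _ Hh (Rmin_r _ _)).
  assert (Hb' := Rlt_le_trans _ _ _ Hb (Rmin_r _ _)).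
  apply Rlt_le_trans with (2 := Rmin_l _ _) in Hb.
  assert (Hc1 := Rlt_le_trans _ _ _ Hb' (Rmin_l _ _)).
  assert (Hc2 := Rlt_le_trans _ _ _ Hb' (Rmin_r _ _)).
  assert (Ha1 := Rlt_le_trans _ _ _ Ha (Rmin_l _ _)).
  assert (Ha2 := Rlt_le_trans _ _ _ Ha (Rmin_r _ _)).
  set (D := Cmod (x, y)) in *.
  assert (Hx : Rabs x <= D) by apply (re_le_Cmod (x, y)).
  assert (Hy : Rabs y <= D) by apply (im_le_Cmod (x, y)).
  assert (Hx0 := Rabs_pos x). assert (Hy0 := Rabs_pos y).
  specialize (H1 x ltac:(lra)). specialize (H2 y ltac:(lra)). specialize (H3 y ltac:(lra)).
  rewrite exp_0, Rmult_1_l in H1. rewrite sin_0, cos_0, Rminus_0_r, Rmult_1_l in H2.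
  rewrite cos_0, sin_0, Ropp_0, Rmult_0_l, Rminus_0_r in H3.
  assert (X1 : Rabs (exp x - 1) <= 2 * Rabs x).
  { replace (exp x - 1) with ((exp x - 1 - x) + x) by ring.
    eapply Rle_trans; [apply Rabs_triang|]. nra. }
  assert (X2 : Rabs (exp x) <= 2).
  { replace (exp x) with ((exp x - 1) + 1) by ring.
    eapply Rle_trans; [apply Rabs_triang|]. rewrite (Rabs_pos_eq 1) by lra. lra. }
  eapply Rle_trans; [apply Cmod_le_abs|]. simpl.
  replace (exp x * cos y + - (1) + - x) with ((exp x - 1 - x) + exp x * (cos y - 1)) by ring.
  replace (exp x * sin y + - 0 + - y) with (exp x * (sin y - y) + (exp x - 1) * y) by ring.
  assert (T1 := Rabs_triang (exp x - 1 - x) (exp x * (cos y - 1))).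
  assert (T2 := Rabs_triang (exp x * (sin y - y)) ((exp x - 1) * y)).
  rewrite Rabs_mult in T1. rewrite !Rabs_mult in T2.
  assert (Y1 : Rabs (exp x) * Rabs (cos y - 1) <= 2 * (e * D)).
  { apply Rmult_le_compat; try apply Rabs_pos; [exact X2|]. nra. }
  assert (Y2 : Rabs (exp x) * Rabs (sin y - y) <= 2 * (e * D)).
  { apply Rmult_le_compat; try apply Rabs_pos; [exact X2|]. nra. }
  assert (Y3 : Rabs (exp x - 1) * Rabs y <= (2 * (eps / 4)) * D).
  { apply Rmult_le_compat; try apply Rabs_pos; lra. }
  assert (Y4 : Rabs (exp x - 1 - x) <= e * D) by nra.
  assert (Y5 : e * D <= eps / 10 * D) by (apply Rmult_le_compat_r; lra).
  lra.
Qed.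

Lemma Cdiff_cexp (z : C) : Cdiff cexp z.
Proof.
  exists (cexp z). intros eps He.
  assert (HE : 0 < exp (Re z)) by apply exp_pos.
  destruct (cexp_near_0 (eps / exp (Re z))) as [d [Hd H]]; [now apply Rdiv_lt_0_compat|].
  exists d. split; [exact Hd|]. intros w Hw. specialize (H _ Hw).
  replace (cexp w) with (cexp z * cexp (w - z))%C.
  2:{ rewrite <- cexp_plus. f_equal. ring. }
  replace (cexp z * cexp (w - z) - cexp z - cexp z * (w - z))%C
    with (cexp z * (cexp (w - z) - 1 - (w - z)))%C by ring.
  rewrite Cmod_mult, Cmod_cexp.
  apply Rmult_le_compat_l with (r := exp (Re z)) in H; [|lra].
  eapply Rle_trans; [exact H|]. right. field. lra.
Qed.

(** * Decay of functions of the Bernstein class on short intervals with many zeros *)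

Lemma exp_monotone (x y : R) : x <= y -> exp x <= exp y.
Proof. intros [H|<-]; [left; now apply exp_increasing|apply Rle_refl]. Qed.

(** Since [sigma] may be negative near 0, y sigma(y) need not be monotone; a nonnegative bound [A]
    covers that range and y = 0. *)
Lemma growth_le (sigma : R -> R) (y s A : R) :
  (forall u v, 0 < u -> u <= v -> sigma u <= sigma v) ->
  0 <= y <= s -> s * sigma s <= A -> 0 <= A -> y * sigma y <= A.
Proof.
  intros Hm Hy Hs HA. destruct (Rle_lt_or_eq_dec 0 y (proj1 Hy)) as [Hy0|<-]; [|lra].
  assert (H := Hm y s Hy0 (proj2 Hy)).
  destruct (Rle_lt_dec (sigma y) 0) as [Hn|Hp]; [nra|].
  assert (y * sigma y <= s * sigma s) by (apply Rmult_le_compat; lra). lra.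
Qed.

Lemma side_bound_growth (F : C -> C) (sigma : R -> R) (CF s A x0 x1 : R) :
  (forall u v, 0 < u -> u <= v -> sigma u <= sigma v) -> 0 < CF -> 0 < s ->
  (forall z, Cmod (F z) <= CF * exp (Rabs (Im z) * sigma (Rabs (Im z)))) ->
  s * sigma s <= A -> 0 <= A -> side_bound F x0 x1 (0 - s) (0 + s) (CF * exp A).
Proof.
  intros Hm HCF Hs HF HA HA0.
  assert (H : forall x y, - s <= y <= s -> Cmod (F (x, y)) <= CF * exp A).
  { intros x y Hy. eapply Rle_trans; [apply HF|]. simpl.
    apply Rmult_le_compat_l; [lra|]. apply exp_monotone.
    apply (growth_le sigma _ s); auto. split; [apply Rabs_pos|apply Rabs_le; lra]. }
  split; intros t Ht; split; apply H; lra.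
Qed.

Lemma decay_on_interval (Lam : R -> Prop) (Psi sigma : R -> R) (F : C -> C) (CF a b x : R) :
  (forall u v, 0 < u -> u <= v -> sigma u <= sigma v) ->
  (forall u, 0 < u -> sigma u <= / (2 * exp 1) * Psi (u / (2 * exp 1))) ->
  (forall z, Cdiff F z) -> 0 < CF ->
  (forall z, Cmod (F z) <= CF * exp (Rabs (Im z) * sigma (Rabs (Im z)))) ->
  (forall t, Lam t -> F (RtoC t) = 0) ->
  count_gt Lam a b (Psi (b - a) * (b - a)) -> a < x < b ->
  Cmod (F (RtoC x)) <= CF * exp (- (Rmax 0 (Psi (b - a) * (b - a)) / 4)).
Proof.
  intros Hm Ha HF HCF HB HL [l [Hnd [Hl Hlen]]] Hx.
  set (d := b - a) in *. assert (Hd : 0 < d) by (unfold d; lra).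
  (* [Psi] may be negative on short lengths; the claim is then the boundedness of F on the real
     line. *)
  destruct (Rle_lt_dec (Psi d) 0) as [Hneg|Hpos].
  { rewrite Rmax_left by nra. eapply Rle_trans; [apply HB|]. simpl.
    rewrite Rabs_R0. apply Rmult_le_compat_l; [lra|]. apply exp_monotone. lra. }
  assert (HA : 0 < Psi d * d) by nra.
  rewrite Rmax_right by lra.
  assert (He : 2 <= exp 1) by (assert (He := exp_ineq1 1); lra).
  (* At this scale (a) reads s sigma(s) <= d Psi(d). *)
  set (s := 2 * exp 1 * d). assert (Hs : 4 * d <= s) by (unfold s; nra).
  assert (HsA : s * sigma s <= Psi d * d).
  { assert (H := Ha s ltac:(lra)).
    replace (s / (2 * exp 1)) with d in H by (unfold s; field; lra).
    apply Rmult_le_compat_l with (r := s) in H; [|lra].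
    eapply Rle_trans; [exact H|]. right. unfold s. field. lra. }
  assert (Hsm := many_zeros_small F (map RtoC l) ((a + b) / 2, 0) (RtoC x) s (d / 2) (d / 2)
    (CF * exp (Psi d * d)) HF).
  assert (Hmod : forall t, a < t < b -> Cmod (RtoC t - ((a + b) / 2, 0)) <= d / 2).
  { intros t Ht. change (RtoC t) with (t, 0). rewrite pair_minus.
    eapply Rle_trans; [apply Cmod_le_abs|]. rewrite Rminus_diag, Rabs_R0, Rplus_0_r.
    unfold d. apply Rabs_le. lra. }
  simpl Re in Hsm. simpl Im in Hsm.
  eapply Rle_trans; [apply Hsm|].
  - apply Injective_map_NoDup; [|exact Hnd]. intros u v E. now injection E.
  - intros lam Hlam. apply in_map_iff in Hlam. destruct Hlam as [t [<- Ht]].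
    destruct (Hl t Ht) as [Lt It]. split; [now apply HL|now apply Hmod].
  - lra.
  - lra.
  - now apply Hmod.
  - unfold d in *. lra.
  - lra.
  - apply (side_bound_growth F sigma); auto; lra.
  - rewrite length_map.
    replace (d / 2 + d / 2) with d by field.
    set (N := length l) in *.
    (* The gain per zero is 1 / (2 e - 1/2). After a factor 1 / e is split off, the claim follows
       from exp(- 1/4) >= 3/4 and 2 - 1 / (2 e) >= 7/4, whose product exceeds 1. More than d Psi(d)
       zeros then outweigh the growth exp (d Psi(d)). *)
    assert (Hrho : d / (s - d / 2) <= exp (- (5 / 4))).
    { apply (Rmult_le_reg_r (s - d / 2)); [lra|].
      unfold Rdiv at 1. rewrite Rmult_assoc, Rinv_l, Rmult_1_r by lra.
      replace (- (5 / 4)) with (- (1) + - (1 / 4)) by field.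
      rewrite exp_plus, exp_Ropp.
      assert (Hq := exp_ineq1 (- (1 / 4)) ltac:(lra)).
      replace (s - d / 2) with (exp 1 * (2 * d - d / 2 / exp 1)) by (unfold s; field; lra).
      assert (Hi : / exp 1 <= / 2) by (apply Rinv_le_contravar; lra).
      replace (/ exp 1 * exp (- (1 / 4)) * (exp 1 * (2 * d - d / 2 / exp 1)))
        with (exp (- (1 / 4)) * (2 * d - d / 2 / exp 1)) by (field; lra).
      assert (d / 2 / exp 1 <= d / 2 * / 2) by (apply Rmult_le_compat_l; lra).
      nra. }
    assert (Hr0 : 0 <= d / (s - d / 2)) by (left; apply Rdiv_lt_0_compat; lra).
    rewrite Rmult_assoc. apply Rmult_le_compat_l; [lra|].
    apply Rle_trans with (exp (Psi d * d) * exp (- (5 / 4)) ^ N).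
    + apply Rmult_le_compat_l; [left; apply exp_pos|]. apply pow_incr. split; assumption.
    + assert (Hpow : forall n t, exp t ^ n = exp (INR n * t)).
      { induction n as [|n IH]; intros t; [simpl; rewrite Rmult_0_l, exp_0; reflexivity|].
        rewrite S_INR. simpl. rewrite IH, <- exp_plus. f_equal. ring. }
      rewrite Hpow, <- exp_plus. apply exp_monotone. lra.
Qed.

(** * Harmonic test functions *)

(* With [w = - 1 / z], which sends (a, b) to an interval of centre [- inv_center a b]
   and half-length [2 * inv_scale a b], the function below is [i u - 2 u ^ 2] for
   [u = s / (w + tau + i s)].  On the real axis its real part is
   [s^2 (3 s^2 - xi^2) / (xi^2 + s^2)^2] with [xi = w + tau]: at most 3, and
   negative off (a, b). *)
Definition inv_center (a b : R) : R := (/ a + / b) / 2.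
Definition inv_scale (a b : R) : R := (/ a - / b) / 4.
Definition test_ratio (a b : R) (z : C) : C :=
  (RtoC (inv_scale a b) * z / ((inv_center a b, inv_scale a b) * z - 1))%C.
Definition test_fun (a b : R) (z : C) : C := (Ci * test_ratio a b z - 2 * (test_ratio a b z * test_ratio a b z))%C.

Lemma inv_scale_pos (a b : R) : 0 < a < b -> 0 < inv_scale a b.
Proof.
  intros H. unfold inv_scale. assert (/ b < / a) by (apply Rinv_lt_contravar; nra). lra.
Qed.

(** The only zero is 1 / (tau + i s), which lies in the open lower half-plane. *)
Lemma test_den_neq_0 (tau s : R) (z : C) : 0 < s -> 0 <= Im z -> ((tau, s) * z - 1)%C <> 0.
Proof.
  destruct z as [x y]; simpl. intros Hs Hy E. injection E as E1 E2.
  assert (y * (tau * tau + s * s) = - s).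
  { replace (y * (tau * tau + s * s)) with
      (tau * (tau * y + s * x + - 0) - s * (tau * x - s * y + - (1)) - s) by ring.
    rewrite E1, E2. ring. }
  nra.
Qed.

Lemma test_fun_Cdiff (a b : R) (z : C) : 0 < a < b -> 0 <= Im z -> Cdiff (test_fun a b) z.
Proof.
  intros Hab Hz.
  assert (Hu : Cdiff (test_ratio a b) z).
  { apply (Cdiff_mult (fun z => RtoC (inv_scale a b) * z)%C (fun z => / ((inv_center a b, inv_scale a b) * z - 1))%C).
    - apply (Cdiff_mult (fun _ => RtoC (inv_scale a b)) (fun z => z)); [apply Cdiff_const|apply Cdiff_id].
    - apply (Cdiff_inv (fun z => (inv_center a b, inv_scale a b) * z - 1)%C).
      + apply (Cdiff_minus (fun z => (inv_center a b, inv_scale a b) * z)%C (fun _ => RtoC 1));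
          [|apply Cdiff_const].
        apply (Cdiff_mult (fun _ => (inv_center a b, inv_scale a b)) (fun z => z));
          [apply Cdiff_const|apply Cdiff_id].
      + apply test_den_neq_0; [now apply inv_scale_pos|exact Hz]. }
  apply (Cdiff_minus (fun z => Ci * test_ratio a b z)%C (fun z => 2 * (test_ratio a b z * test_ratio a b z))%C).
  - apply (Cdiff_mult (fun _ => Ci)); [apply Cdiff_const|exact Hu].
  - apply (Cdiff_mult (fun _ => RtoC 2)); [apply Cdiff_const|now apply Cdiff_mult].
Qed.

(** The real part of i u - 2 u^2 at u = s / (xi + i h). The first term is a Poisson kernel, positive
    everywhere; the second makes the sum negative on the real axis far from the centre. *)
Definition test_kernel (s xi h : R) : R :=
  s * h / (xi ^ 2 + h ^ 2) - 2 * s ^ 2 * (xi ^ 2 - h ^ 2) / (xi ^ 2 + h ^ 2) ^ 2.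

Lemma Re_test_fun (a b x y : R) : 0 < a < b -> 0 <= y -> 0 < x ^ 2 + y ^ 2 ->
  Re (test_fun a b (x, y)) =
    test_kernel (inv_scale a b) (inv_center a b - x / (x ^ 2 + y ^ 2)) (y / (x ^ 2 + y ^ 2) + inv_scale a b).
Proof.
  intros Hab Hy HN. set (s := inv_scale a b). set (tau := inv_center a b).
  assert (Hs : 0 < s) by now apply inv_scale_pos.
  set (xi := tau - x / (x ^ 2 + y ^ 2)). set (h := y / (x ^ 2 + y ^ 2) + s).
  assert (Hh : 0 < h).
  { unfold h. assert (0 <= y / (x ^ 2 + y ^ 2)); [|lra].
    apply Rmult_le_pos; [exact Hy|]. left. now apply Rinv_0_lt_compat. }
  assert (HE : 0 < xi ^ 2 + h ^ 2) by nra.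
  assert (Hz : (x, y) <> RtoC 0).
  { intros E. injection E as -> ->. lra. }
  assert (Ew : ((tau, s) - / (x, y))%C = (xi, h)).
  { unfold Cinv, Cminus, Cplus, Copp; simpl. unfold xi, h.
    f_equal; field; simpl in *; lra. }
  assert (Eu : test_ratio a b (x, y) = (s * xi / (xi ^ 2 + h ^ 2), - (s * h / (xi ^ 2 + h ^ 2)))).
  { transitivity (RtoC s * / (xi, h))%C.
    - rewrite <- Ew. unfold test_ratio. fold s tau. field. split; [exact Hz|].
      now apply test_den_neq_0.
    - unfold Cinv, RtoC, Cmult; simpl. f_equal; field; simpl in *; lra. }
  unfold test_fun. rewrite Eu. unfold test_kernel, Ci, RtoC, Cminus, Cplus, Copp, Cmult, Re; simpl.
  field. simpl in HE. lra.
Qed.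

Lemma test_kernel_real_le_3 (s xi : R) : 0 < s -> test_kernel s xi s <= 3.
Proof.
  intros Hs. unfold test_kernel. assert (HE : 0 < xi ^ 2 + s ^ 2) by nra.
  apply Rminus_le_0.
  replace (3 - _) with ((3 * xi ^ 4 + 7 * xi ^ 2 * s ^ 2) / (xi ^ 2 + s ^ 2) ^ 2).
  - apply Rmult_le_pos; [|left; apply Rinv_0_lt_compat, pow_lt, HE].
    assert (0 <= xi ^ 2) by apply pow2_ge_0. assert (0 <= s ^ 2) by apply pow2_ge_0. nra.
  - field. lra.
Qed.

(** The majorant is 2 s times the Poisson kernel with pole at the centre of the interval: it is 0 on
    the real axis eta = 0 and decays away from it. *)
Lemma test_kernel_far (s xi eta : R) : 0 < s -> 0 <= eta -> 2 * s <= Rabs xi ->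
  test_kernel s xi (eta + s) <= 2 * s * (eta / (xi ^ 2 + eta ^ 2)).
Proof.
  intros Hs He Hxi. set (X := xi ^ 2).
  assert (HX : 4 * s ^ 2 <= X).
  { unfold X. rewrite <- (pow2_abs xi). nra. }
  unfold test_kernel. fold X.
  assert (HE : 0 < X + (eta + s) ^ 2) by nra.
  assert (HE' : 0 < X + eta ^ 2) by nra.
  apply Rminus_le_0.
  replace (_ - _) with (s * (2 * eta * (X + (eta + s) ^ 2) ^ 2
     - (X + eta ^ 2) * ((eta + s) * (X + (eta + s) ^ 2) - 2 * s * (X - (eta + s) ^ 2)))
     / ((X + eta ^ 2) * (X + (eta + s) ^ 2) ^ 2)) by (field; lra).
  apply Rmult_le_pos.
  2:{ left. apply Rinv_0_lt_compat. apply Rmult_lt_0_compat; [exact HE'|]. now apply pow_lt. }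
  apply Rmult_le_pos; [lra|].
  (* In terms of V = xi^2 - 4 s^2 >= 0 the numerator is a polynomial in V, s, eta with nonnegative
     coefficients. *)
  replace X with ((X - 4 * s ^ 2) + 4 * s ^ 2) by ring.
  assert (HX0 : 0 <= X - 4 * s ^ 2) by lra.
  set (V := X - 4 * s ^ 2) in *. clearbody V.
  ring_simplify.
  repeat apply Rplus_le_le_0_compat; repeat apply Rmult_le_pos; try apply pow_le; lra.
Qed.

Lemma test_fun_real_le (a b x : R) : 0 < a < b ->
  Re (test_fun a b (x, 0)) <= 3 /\ (~ a < x < b -> Re (test_fun a b (x, 0)) <= 0).
Proof.
  intros Hab. assert (Hs := inv_scale_pos a b Hab).
  (* z = 0 corresponds to w = infinity, where [Re_test_fun] does not apply. *)
  destruct (Req_dec x 0) as [->|Hx].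
  { replace (Re (test_fun a b (0, 0))) with 0; [split; [lra|intros _; lra]|].
    change (0, 0) with (RtoC 0).
    assert (E : test_ratio a b (RtoC 0) = RtoC 0) by (unfold test_ratio, Cdiv; ring).
    unfold test_fun. rewrite E. unfold Ci, RtoC, Cminus, Cplus, Copp, Cmult, Re; simpl. ring. }
  assert (HN : 0 < x ^ 2 + 0 ^ 2) by nra.
  rewrite Re_test_fun; try lra.
  replace (0 / (x ^ 2 + 0 ^ 2) + inv_scale a b) with (inv_scale a b) by (field; lra).
  replace (x / (x ^ 2 + 0 ^ 2)) with (/ x) by (field; repeat split; lra).
  split; [now apply test_kernel_real_le_3|]. intros Hn.
  replace (inv_scale a b) with (0 + inv_scale a b) at 2 by ring.
  eapply Rle_trans; [apply test_kernel_far; try lra|].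
  - assert (Hab1 : / b < / a) by (apply Rinv_lt_contravar; nra).
    assert (Hb0 : 0 < / b) by (apply Rinv_0_lt_compat; lra).
    (* Off (a, b) the point 1 / x is off (1 / b, 1 / a), an interval of half-length 2 s about
       tau. *)
    assert (Hout : / a <= / x \/ / x <= / b).
    { destruct (Rlt_le_dec x 0) as [H0|H0].
      - right. apply Rinv_lt_0_compat in H0. lra.
      - destruct (Rle_lt_dec x a); [left; apply Rinv_le_contravar; lra|].
        right. apply Rinv_le_contravar; lra. }
    unfold inv_center, inv_scale. destruct Hout; [rewrite Rabs_left1|rewrite Rabs_pos_eq]; lra.
  - right. unfold Rdiv. ring.
Qed.

(** The majorant of [test_kernel_far] equals 2 s y / |tau z - 1|^2, and |tau z - 1| >= Y / b on the
    far sides of the rectangle; the slope is the resulting coefficient of y. *)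
Definition test_slope (a b Y : R) : R := 2 * inv_scale a b * b ^ 2 / Y ^ 2.

Lemma test_fun_far (a b Y x y : R) : 0 < a < b -> 2 * b <= Y -> 0 <= y ->
  y = Y \/ Y + b <= Rabs x -> Re (test_fun a b (x, y)) <= test_slope a b Y * y.
Proof.
  intros Hab HY Hy Hfar. assert (Hs := inv_scale_pos a b Hab).
  assert (HY0 : 0 < Y) by lra.
  assert (HxN : Y * Rabs x <= x ^ 2 + y ^ 2).
  { rewrite <- (pow2_abs x). assert (H := Rabs_pos x).
    destruct Hfar as [->|Hfar]; nra. }
  assert (HN : 0 < x ^ 2 + y ^ 2).
  { destruct Hfar as [->|Hfar]; [assert (H := pow2_ge_0 x); nra|].
    eapply Rlt_le_trans; [|exact HxN]. nra. }
  rewrite Re_test_fun by assumption.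
  set (N := x ^ 2 + y ^ 2) in *. set (tau := inv_center a b) in *. set (s := inv_scale a b) in *.
  assert (Hb0 : 0 < / b) by (apply Rinv_0_lt_compat; lra).
  assert (Hab1 : / b < / a) by (apply Rinv_lt_contravar; nra).
  assert (Htau : / b <= tau) by (unfold tau, inv_center; lra).
  (* This gives tau - x / N >= tau - 1 / b = 2 s, as [test_kernel_far] requires. *)
  assert (HxN' : x / N <= / b).
  { apply (Rmult_le_reg_r (N * b)); [nra|].
    replace (x / N * (N * b)) with (x * b) by (field; lra).
    replace (/ b * (N * b)) with N by (field; lra).
    assert (H := Rle_abs x). assert (H' := Rabs_pos x). nra. }
  eapply Rle_trans; [apply test_kernel_far|].
  - exact Hs.
  - apply Rmult_le_pos; [exact Hy|left; now apply Rinv_0_lt_compat].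
  - eapply Rle_trans; [|apply Rle_abs]. unfold tau, inv_center, s, inv_scale in *. lra.
  - set (E := (tau * x - 1) ^ 2 + (tau * y) ^ 2).
    assert (HE : (Y / b) ^ 2 <= E).
    { assert (HYb : 0 <= Y / b <= tau * Y).
      { split; [left; now apply Rdiv_lt_0_compat; lra|].
        unfold Rdiv. rewrite Rmult_comm. apply Rmult_le_compat_r; lra. }
      unfold E. destruct Hfar as [->|Hfar].
      - assert (H := pow2_ge_0 (tau * x - 1)). assert (H' := pow_incr _ _ 2 HYb). lra.
      (* The margin b in Y + b absorbs the 1, because tau b >= 1. *)
      - assert (H : tau * Y <= Rabs (tau * x - 1)).
        { assert (Hbt : 1 <= tau * b).
          { replace 1 with (/ b * b) by (field; lra). apply Rmult_le_compat_r; lra. }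
          assert (T := Rabs_triang_inv (tau * x) 1).
          rewrite Rabs_mult, (Rabs_pos_eq tau), Rabs_R1 in T by lra. nra. }
        rewrite <- (pow2_abs (tau * x - 1)).
        assert (H' := pow_incr (Y / b) (Rabs (tau * x - 1)) 2 ltac:(lra)).
        assert (H2 := pow2_ge_0 (tau * y)). lra. }
    assert (HYb0 : 0 < (Y / b) ^ 2) by (apply pow_lt, Rdiv_lt_0_compat; lra).
    assert (EE : (tau - x / N) ^ 2 + (y / N) ^ 2 = E / N).
    { unfold E. replace ((tau * x - 1) ^ 2 + (tau * y) ^ 2) with
        (tau ^ 2 * N - 2 * tau * x + 1) by (unfold N; ring).
      transitivity (tau ^ 2 - 2 * tau * x / N + N / N ^ 2); [unfold N; field; unfold N in *; lra|].
      field. lra. }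
    rewrite EE. replace (y / N / (E / N)) with (y / E) by (field; split; lra).
    unfold test_slope. fold s.
    replace (2 * s * b ^ 2 / Y ^ 2 * y) with (2 * s * (y / (Y / b) ^ 2)) by (field; split; lra).
    apply Rmult_le_compat_l; [lra|]. apply Rmult_le_compat_l; [exact Hy|].
    now apply Rinv_le_contravar.
Qed.

(** As a tends to infinity, tau and s tend to 0 and the real part divided by s tends to (y / N) / (1
    / N) = y. The factor 3/4 leaves room for the error and still exceeds the 1/2 later lost to the
    slope. *)
Lemma test_fun_lower (x y : R) : 0 < y -> exists delta, 0 < delta /\
  forall a b, 0 < a < b -> / a <= delta -> 3 / 4 * y * inv_scale a b <= Re (test_fun a b (x, y)).
Proof.
  intros Hy. set (N := x ^ 2 + y ^ 2).
  assert (HN : 0 < N) by (unfold N; assert (H := pow2_ge_0 x); nra).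
  set (eta := y / N). assert (Heta : 0 < eta) by now apply Rdiv_lt_0_compat.
  set (B := 3 / 4 * y * (2 * Rabs (x / N) + 2 + 2 * eta) + 1).
  assert (HB : 0 < B).
  { unfold B. assert (H := Rabs_pos (x / N)). nra. }
  set (delta := Rmin 1 (eta / (4 * B))).
  assert (Hd : 0 < delta) by (unfold delta; apply Rmin_pos; [lra|apply Rdiv_lt_0_compat; lra]).
  assert (Hd1 : delta <= 1) by apply Rmin_l.
  assert (Hd2 : delta * B <= eta / 4).
  { apply Rle_trans with (eta / (4 * B) * B); [|right; field; lra].
    apply Rmult_le_compat_r; [lra|apply Rmin_r]. }
  exists delta. split; [exact Hd|]. intros a b Hab Ha.
  assert (Hs := inv_scale_pos a b Hab).
  rewrite Re_test_fun by (unfold N in HN; lra). fold N. fold eta.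
  assert (Hb0 : 0 < / b) by (apply Rinv_0_lt_compat; lra).
  assert (Hab1 : / b < / a) by (apply Rinv_lt_contravar; nra).
  assert (Htau : 0 <= inv_center a b <= delta) by (unfold inv_center; lra).
  assert (Hsd : inv_scale a b <= delta) by (unfold inv_scale; lra).
  set (s := inv_scale a b) in *. set (tau := inv_center a b) in *.
  set (xi := tau - x / N). set (h := eta + s).
  assert (Hh : 0 < h) by (unfold h; lra).
  assert (HE : 0 < xi ^ 2 + h ^ 2) by nra.
  set (E := xi ^ 2 + h ^ 2) in *.
  (* The kernel exceeds this quantity by exactly 4 s^2 h^2 / E^2. *)
  apply Rle_trans with (s * ((eta - s) / E)).
  - rewrite (Rmult_comm (3 / 4 * y)). apply Rmult_le_compat_l; [lra|].
    apply (Rmult_le_reg_r E); [exact HE|].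
    replace ((eta - s) / E * E) with (eta - s) by (field; lra).
    assert (HEle : E <= / N + delta * (2 * Rabs (x / N) + 2 + 2 * eta)).
    { replace (/ N) with ((x / N) ^ 2 + eta ^ 2).
      2:{ unfold eta. transitivity (N / N ^ 2); [unfold N; field; unfold N in *; lra|field; lra]. }
      unfold E, xi, h. assert (H := Rle_abs (- (x / N))). rewrite Rabs_Ropp in H.
      assert (H' := Rabs_pos (x / N)).
      assert (tau * (- (x / N)) <= delta * Rabs (x / N)).
      { apply Rle_trans with (tau * Rabs (x / N)); [apply Rmult_le_compat_l; lra|].
        apply Rmult_le_compat_r; lra. }
      assert (tau * tau <= delta * 1) by (apply Rmult_le_compat; lra).
      assert (s * s <= delta * 1) by (apply Rmult_le_compat; lra).
      assert (s * eta <= delta * eta) by (apply Rmult_le_compat_r; lra).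
      nra. }
    apply Rle_trans with (3 / 4 * y * (/ N + delta * (2 * Rabs (x / N) + 2 + 2 * eta))).
    + apply Rmult_le_compat_l; lra.
    + replace (3 / 4 * y * (/ N + delta * (2 * Rabs (x / N) + 2 + 2 * eta)))
        with (3 / 4 * eta + delta * (B - 1)) by (unfold B, eta; field; lra). lra.
  - unfold test_kernel. fold E.
    apply Rminus_le_0.
    replace (_ - _) with (4 * s ^ 2 * h ^ 2 / E ^ 2).
    + apply Rmult_le_pos; [|left; now apply Rinv_0_lt_compat, pow_lt].
      repeat apply Rmult_le_pos; try apply pow2_ge_0; lra.
    + transitivity ((s * h * E - 2 * s ^ 2 * (xi ^ 2 - h ^ 2) - s * (eta - s) * E) / E ^ 2);
        [|field; lra].
      f_equal. unfold E, h. ring.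
Qed.

(** * The weighted sum of test functions and the main estimate *)

Fixpoint csum (T : nat -> C -> C) (n : nat) (z : C) : C :=
  match n with O => RtoC 0 | S n => (csum T n z + T (S n) z)%C end.

Lemma sum_n_m_1_S (t : nat -> R) (n : nat) :
  sum_n_m t 1 (S n) = sum_n_m t 1 n + t (S n).
Proof. rewrite sum_n_Sm by lia. reflexivity. Qed.

Lemma sum_n_m_1_0 (t : nat -> R) : sum_n_m t 1 0 = 0.
Proof. exact (@sum_n_m_zero R_AbelianMonoid t 1 0 (Nat.lt_0_succ 0)). Qed.

Lemma Re_csum (T : nat -> C -> C) (n : nat) (z : C) :
  Re (csum T n z) = sum_n_m (fun k => Re (T k z)) 1 n.
Proof.
  induction n as [|n IH]; [now rewrite sum_n_m_1_0|].
  rewrite sum_n_m_1_S, <- IH. reflexivity.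
Qed.

Lemma Cdiff_csum (T : nat -> C -> C) (n : nat) (z : C) :
  (forall k, (1 <= k <= n)%nat -> Cdiff (T k) z) -> Cdiff (csum T n) z.
Proof.
  induction n as [|n IH]; intros H.
  - exact (Cdiff_const (RtoC 0) z).
  - apply (Cdiff_plus (csum T n) (T (S n))); [apply IH; intros; apply H; lia|apply H; lia].
Qed.

Lemma sum_le_compat (t u : nat -> R) (n : nat) :
  (forall k, (1 <= k <= n)%nat -> t k <= u k) -> sum_n_m t 1 n <= sum_n_m u 1 n.
Proof.
  induction n as [|n IH]; intros H; [rewrite !sum_n_m_1_0; lra|].
  rewrite !sum_n_m_1_S. apply Rplus_le_compat; [apply IH; intros; apply H; lia|apply H; lia].
Qed.

Lemma sum_nonpos (t : nat -> R) (n : nat) :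
  (forall k, (1 <= k <= n)%nat -> t k <= 0) -> sum_n_m t 1 n <= 0.
Proof.
  induction n as [|n IH]; intros H; [rewrite sum_n_m_1_0; lra|].
  rewrite sum_n_m_1_S. assert (A := H (S n) ltac:(lia)).
  assert (B : sum_n_m t 1 n <= 0) by (apply IH; intros; apply H; lia). lra.
Qed.

Lemma sum_one_pos (t : nat -> R) (n j : nat) : (1 <= j <= n)%nat ->
  (forall k, (1 <= k <= n)%nat -> k <> j -> t k <= 0) -> sum_n_m t 1 n <= t j.
Proof.
  induction n as [|n IH]; intros Hj H; [lia|].
  rewrite sum_n_m_1_S. destruct (Nat.eq_dec j (S n)) as [->|Hne].
  - assert (B : sum_n_m t 1 n <= 0) by (apply sum_nonpos; intros; apply H; lia). lra.
  - assert (A := H (S n) ltac:(lia) ltac:(lia)).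
    assert (B : sum_n_m t 1 n <= t j) by (apply IH; [lia|intros; apply H; lia]). lra.
Qed.

Lemma bound_by_test_funs (F : C -> C) (sigma : R -> R) (CF : R) (a b m : nat -> R) (n : nat) (z0 : C) :
  (forall u v, 0 < u -> u <= v -> sigma u <= sigma v) ->
  (forall z, Cdiff F z) -> 0 < CF ->
  (forall z, Cmod (F z) <= CF * exp (Rabs (Im z) * sigma (Rabs (Im z)))) ->
  (forall k, (1 <= k)%nat -> 0 < a k < b k) ->
  (forall j k, (1 <= j)%nat -> (j < k)%nat -> b j < a k) ->
  (forall k, 0 <= m k) ->
  (forall k x, (1 <= k)%nat -> a k < x < b k -> Cmod (F (RtoC x)) <= CF * exp (- (3 * m k))) ->
  (1 <= n)%nat -> 0 < Im z0 < 2 * b n -> Rabs (Re z0) < 2 * b n ->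
  Cmod (F z0) <= CF * exp (sigma (2 * b n) * Im z0 -
    sum_n_m (fun k => m k * (Re (test_fun (a k) (b k) z0) - test_slope (a k) (b k) (2 * b n) * Im z0)) 1 n).
Proof.
  intros Hm HF HCF HB Hab Hord Hm0 Hdec Hn Hy0 Hx0.
  set (Y := 2 * b n) in *.
  (* The added linear term has real part - slope * y: it makes the real part of [T] nonpositive on
     the top and lateral sides and changes nothing on the real axis. *)
  set (T := fun (k : nat) (z : C) =>
    (RtoC (m k) * (test_fun (a k) (b k) z + Ci * RtoC (test_slope (a k) (b k) Y) * z))%C).
  assert (HT : forall k z, Re (T k z) = m k * (Re (test_fun (a k) (b k) z) - test_slope (a k) (b k) Y * Im z)).
  { intros k z. unfold T. rewrite Re_scal. f_equal.
    destruct (test_fun (a k) (b k) z), z. unfold Ci, RtoC, Cplus, Cmult, Re, Im; simpl. ring. }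
  set (g := fun z => (Ci * RtoC (sigma Y) * z + csum T n z)%C).
  assert (Hg : forall z, Re (g z) = - sigma Y * Im z + sum_n_m (fun k => Re (T k z)) 1 n).
  { intros z. rewrite <- Re_csum. unfold g. destruct z as [u v]. destruct (csum T n (u, v)).
    unfold Ci, RtoC, Cplus, Cmult, Re, Im; simpl. ring. }
  set (H := fun z => (F z * cexp (g z))%C).
  assert (Hle : forall k, (1 <= k <= n)%nat -> b k <= b n).
  { intros k Hk. destruct (Nat.eq_dec k n) as [->|Hne]; [lra|].
    assert (A := Hord k n ltac:(lia) ltac:(lia)). assert (B := Hab n Hn). lra. }
  assert (HbN := Hab n Hn).
  assert (Hslope : forall k, (1 <= k <= n)%nat -> 0 <= test_slope (a k) (b k) Y).
  { intros k Hk. unfold test_slope. assert (A := inv_scale_pos _ _ (Hab k (proj1 Hk))).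
    apply Rmult_le_pos; [|left; apply Rinv_0_lt_compat, pow_lt; unfold Y; lra].
    apply Rmult_le_pos; [lra|apply pow2_ge_0]. }
  assert (Hstrip : forall x y, 0 <= y <= Y -> Cmod (F (x, y)) <= CF * exp (sigma Y * y)).
  { intros x y Hy. eapply Rle_trans; [apply HB|]. simpl.
    apply Rmult_le_compat_l; [lra|]. apply exp_monotone. rewrite Rabs_pos_eq by lra.
    rewrite Rmult_comm. destruct (Rle_lt_or_eq_dec 0 y (proj1 Hy)) as [Hp|<-]; [|lra].
    apply Rmult_le_compat_r; [lra|]. apply Hm; lra. }
  assert (Hout : forall x y, 0 <= y <= Y -> y = Y \/ Y + b n <= Rabs x -> Cmod (H (x, y)) <= CF).
  { intros x y Hy Hfar. unfold H. rewrite Cmod_mult, Cmod_cexp, Hg. simpl Im.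
    assert (HS : sum_n_m (fun k => Re (T k (x, y))) 1 n <= 0).
    { apply sum_nonpos. intros k Hk. rewrite HT. simpl Im.
      assert (A : Re (test_fun (a k) (b k) (x, y)) <= test_slope (a k) (b k) Y * y).
      { assert (A := Hle k Hk). apply test_fun_far; [apply Hab; lia|unfold Y; lra|lra|].
        destruct Hfar as [Hfar|Hfar]; [now left|right; lra]. }
      assert (B := Hm0 k). nra. }
    apply Rle_trans with (CF * exp (sigma Y * y) * exp (- sigma Y * y + 0)).
    - apply Rmult_le_compat; [apply Cmod_ge_0|left; apply exp_pos|now apply Hstrip|].
      apply exp_monotone. lra.
    - rewrite Rmult_assoc, <- exp_plus.
      replace (sigma Y * y + (- sigma Y * y + 0)) with 0 by ring. rewrite exp_0. lra. }
  assert (Hbot : forall x, Cmod (H (x, 0)) <= CF).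
  { intros x. unfold H. rewrite Cmod_mult, Cmod_cexp, Hg. simpl Im.
    assert (HTx : forall k, (1 <= k <= n)%nat ->
       Re (T k (x, 0)) <= 3 * m k /\ (~ a k < x < b k -> Re (T k (x, 0)) <= 0)).
    { intros k Hk. rewrite HT. simpl Im.
      destruct (test_fun_real_le (a k) (b k) x (Hab k (proj1 Hk))) as [A1 A2].
      assert (B := Hm0 k). split; [nra|]. intros Hnx. specialize (A2 Hnx). nra. }
    (* By disjointness at most one term is positive at x; it is at most 3 m_j, which the decay of F
       on that interval cancels. *)
    destruct (classic (exists j, (1 <= j <= n)%nat /\ a j < x < b j)) as [[j [Hj Hxj]]|Hno].
    - assert (HS : sum_n_m (fun k => Re (T k (x, 0))) 1 n <= 3 * m j).
      { eapply Rle_trans; [apply (sum_one_pos _ n j Hj)|now apply HTx].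
        intros k Hk Hne. apply HTx; [exact Hk|]. intros Hxk.
        destruct (Nat.lt_gt_cases k j) as [Hc _]. destruct (Hc Hne) as [Hlt|Hgt].
        - assert (A := Hord k j ltac:(lia) Hlt). lra.
        - assert (A := Hord j k ltac:(lia) Hgt). lra. }
      apply Rle_trans with (CF * exp (- (3 * m j)) * exp (3 * m j)).
      + apply Rmult_le_compat; [apply Cmod_ge_0|left; apply exp_pos| |].
        * apply (Hdec j x); [lia|exact Hxj].
        * apply exp_monotone. lra.
      + rewrite Rmult_assoc, <- exp_plus. replace (- (3 * m j) + 3 * m j) with 0 by ring.
        rewrite exp_0. lra.
    - assert (HS : sum_n_m (fun k => Re (T k (x, 0))) 1 n <= 0).
      { apply sum_nonpos. intros k Hk. apply HTx; [exact Hk|]. intros Hxk. apply Hno.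
        exists k. now split. }
      apply Rle_trans with (CF * exp (sigma Y * 0) * exp 0).
      + apply Rmult_le_compat; [apply Cmod_ge_0|left; apply exp_pos|apply Hstrip; unfold Y; lra|].
        apply exp_monotone. lra.
      + rewrite Rmult_0_r, exp_0. lra. }
  assert (HH : Cmod (H z0) <= CF).
  { apply (max_modulus H nil (- (Y + b n)) (Y + b n) 0 Y).
    - apply Rabs_def2 in Hx0. lra.
    - lra.
    - intros z [_ Hz].
      assert (D : Cdiff H z).
      { apply Cdiff_mult; [apply HF|]. apply (Cdiff_comp g cexp); [|apply Cdiff_cexp].
        apply Cdiff_plus.
        - apply (Cdiff_mult (fun _ => (Ci * RtoC (sigma Y))%C) (fun z => z));
            [apply Cdiff_const|apply Cdiff_id].
        - apply Cdiff_csum. intros k Hk. unfold T.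
          apply (Cdiff_mult (fun _ => RtoC (m k))); [apply Cdiff_const|].
          apply Cdiff_plus; [apply test_fun_Cdiff; [apply Hab; lia|lra]|].
          apply (Cdiff_mult (fun _ => (Ci * RtoC (test_slope (a k) (b k) Y))%C) (fun z => z));
            [apply Cdiff_const|apply Cdiff_id]. }
      split; [now apply Cdiff_Ccont|auto].
    - intros [].
    - split.
      + intros x _. split; [apply Hbot|apply Hout; [unfold Y; lra|now left]].
      + intros y Hy. split; apply Hout; try lra; right.
        * rewrite Rabs_left1; unfold Y; lra.
        * rewrite Rabs_pos_eq; unfold Y; lra. }
  unfold H in HH. rewrite Cmod_mult, Cmod_cexp, Hg in HH.
  assert (ES : sum_n_m (fun k => Re (T k z0)) 1 n = sum_n_m (fun k =>
    m k * (Re (test_fun (a k) (b k) z0) - test_slope (a k) (b k) Y * Im z0)) 1 n).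
  { apply sum_n_m_ext. intros k. apply HT. }
  rewrite ES in HH.
  set (Sg := sum_n_m _ 1 n) in *.
  apply (Rmult_le_reg_r (exp (- sigma Y * Im z0 + Sg))); [apply exp_pos|].
  eapply Rle_trans; [exact HH|]. right.
  rewrite Rmult_assoc, <- exp_plus.
  replace (sigma Y * Im z0 - Sg + (- sigma Y * Im z0 + Sg)) with 0 by ring.
  rewrite exp_0. ring.
Qed.

(** The points p + i / (j + 1) are infinitely many zeros within distance 1 of p. With half-side s =
    r + 3 each gains the factor (r + 1) / (r + 2) < 1, so their number may tend to infinity. *)
Lemma zero_from_upper_half_plane (F : C -> C) (sigma : R -> R) (CF : R) :
  (forall u v, 0 < u -> u <= v -> sigma u <= sigma v) ->
  (forall z, Cdiff F z) -> 0 < CF ->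
  (forall z, Cmod (F z) <= CF * exp (Rabs (Im z) * sigma (Rabs (Im z)))) ->
  (forall z, 0 < Im z -> F z = 0) -> forall z, F z = 0.
Proof.
  intros Hm HF HCF HB H0 [p q].
  set (r := Rabs q). assert (Hr : 0 <= r) by apply Rabs_pos.
  set (s := r + 3). set (A := Rmax 0 (s * sigma s)).
  assert (Hbound : forall n, Cmod (F (p, q)) <= CF * exp A * ((r + 1) / (s - 1)) ^ n).
  { intros n.
    set (l := map (fun j => (p, / INR (S j))) (seq 0 n)).
    assert (Hlen : length l = n) by (unfold l; rewrite length_map, length_seq; reflexivity).
    assert (Hpos : forall j, 0 < / INR (S j)).
    { intros j. apply Rinv_0_lt_compat, lt_0_INR. lia. }
    rewrite <- Hlen at 1.
    apply (many_zeros_small F l (p, 0) (p, q) s 1 r (CF * exp A)); simpl; try (unfold s; lra).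
    - exact HF.
    - apply Injective_map_NoDup; [|apply seq_NoDup]. intros i j E. apply (f_equal snd) in E.
      change (/ INR (S i) = / INR (S j)) in E. apply Rinv_eq_reg, INR_eq in E. now injection E.
    - intros lam Hlam. apply in_map_iff in Hlam. destruct Hlam as [j [<- _]].
      split; [apply H0, Hpos|]. rewrite pair_minus.
      eapply Rle_trans; [apply Cmod_le_abs|].
      rewrite Rminus_diag, Rabs_R0, Rminus_0_r, Rplus_0_l, Rabs_pos_eq by (left; apply Hpos).
      rewrite <- Rinv_1. apply Rinv_le_contravar; [lra|]. rewrite S_INR.
      assert (B := pos_INR j). lra.
    - rewrite pair_minus. eapply Rle_trans; [apply Cmod_le_abs|].
      rewrite Rminus_diag, Rabs_R0, Rminus_0_r. unfold r. lra.
    - assert (B := Rabs_def2 q s). fold r in B. specialize (B ltac:(unfold s; lra)). lra.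
    - apply (side_bound_growth F sigma); auto.
      + unfold s; lra.
      + apply Rmax_r.
      + apply Rmax_l. }
  apply Cmod_eq_0. apply Rle_antisym; [|apply Cmod_ge_0].
  apply Rnot_lt_le. intros Hp.
  set (M := CF * exp A) in *.
  assert (HM : 0 < M) by (apply Rmult_lt_0_compat; [lra|apply exp_pos]).
  assert (Hrho : 0 <= (r + 1) / (s - 1) < 1).
  { split; [apply Rmult_le_pos; [lra|left; apply Rinv_0_lt_compat; unfold s; lra]|].
    apply (Rmult_lt_reg_r (s - 1)); [unfold s; lra|].
    unfold Rdiv. rewrite Rmult_assoc, Rinv_l; unfold s; lra. }
  destruct (pow_lt_1_zero ((r + 1) / (s - 1))) with (y := Cmod (F (p, q)) / M) as [N HN].
  { rewrite Rabs_pos_eq; lra. }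
  { now apply Rdiv_lt_0_compat. }
  specialize (HN N (Nat.le_refl N)). specialize (Hbound N).
  rewrite Rabs_pos_eq in HN by (apply pow_le; lra).
  apply Rmult_lt_compat_l with (r := M) in HN; [|exact HM].
  replace (M * (Cmod (F (p, q)) / M)) with (Cmod (F (p, q))) in HN by (field; lra). lra.
Qed.

Lemma sum_eventually_const (e : nat -> R) (K : nat) :
  (forall k, (K <= k)%nat -> e k = 0) ->
  forall n, (K <= n)%nat -> sum_n_m e 1 n = sum_n_m e 1 K.
Proof.
  intros He n Hn. induction Hn as [|n Hn IH]; [reflexivity|].
  rewrite sum_n_m_1_S, IH, (He (S n)) by lia. apply Rplus_0_r.
Qed.

Lemma is_lim_seq_p_infty_ge (u : nat -> R) (M : R) : is_lim_seq u p_infty ->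
  exists N, forall n, (N <= n)%nat -> M < u n.
Proof. intros H. apply is_lim_seq_spec in H. exact (H M). Qed.

Theorem theorem3p3
  (Lam : R -> Prop) (a b : nat -> R) (Psi sigma : R -> R)
  (* Lambda subset of (0, oo) *)
  (HLam : forall x, Lam x -> 0 < x)
  (* 0 < a_1 < b_1 < a_2 < b_2 < ... , a_k -> +oo *)
  (Ha1 : 0 < a 1%nat)
  (Hab : forall k, (1 <= k)%nat -> a k < b k)
  (Hba : forall k, (1 <= k)%nat -> b k < a (S k))
  (Hainf : is_lim_seq a p_infty)
  (* Psi increasing, Psi(s) -> oo *)
  (HPsi_mono : forall s t, 0 < s -> s <= t -> Psi s <= Psi t)
  (HPsi_inf : is_lim Psi p_infty p_infty)
  (Hsub : substantial Lam Psi a b)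
  (* sigma monotone on (0,oo), sigma(y) -> oo *)
  (Hsig_mono : forall s t, 0 < s -> s <= t -> sigma s <= sigma t)
  (Hsig_inf : is_lim sigma p_infty p_infty)
  (* (a) *)
  (Ha : forall x, 0 < x -> sigma x <= / (2 * exp 1) * Psi (x / (2 * exp 1)))
  (* (b) *)
  (Hb : exists n : nat -> nat,
      is_lim_seq (fun j => INR (n j)) p_infty /\
      is_lim_seq (fun j => / sigma (2 * b (n j)) *
         sum_n_m (fun k => Psi (b k - a k) * ((b k - a k) / b k) ^ 2) 1 (n j))
        p_infty) :
  uniqueness_set Lam sigma.
Proof.
  intros F [Hent [CF [HCF HB]]] HL.
  assert (HF : forall z, Cdiff F z) by (intros z; apply Cdiff_ex_derive, Hent).
  assert (Hord : forall j k, (1 <= j)%nat -> (j < k)%nat -> b j < a k).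
  { intros j k Hj Hjk. induction Hjk as [|k Hjk IH]; [now apply Hba|].
    assert (A := Hba k ltac:(lia)). assert (B := Hab k ltac:(lia)). lra. }
  assert (Hab0 : forall k, (1 <= k)%nat -> 0 < a k < b k).
  { intros k Hk. split; [|now apply Hab]. destruct (Nat.eq_dec k 1) as [->|Hne]; [exact Ha1|].
    assert (A := Hord 1%nat k ltac:(lia) ltac:(lia)). assert (B := Hab 1%nat ltac:(lia)). lra. }
  apply (zero_from_upper_half_plane F sigma CF); auto.
  intros [x y] Hy. simpl in Hy.
  destruct (test_fun_lower x y Hy) as [delta [Hd Hlow]].
  destruct (is_lim_seq_p_infty_ge a (/ delta) Hainf) as [K HK].
  set (P := fun k => Rmax 0 (Psi (b k - a k) * (b k - a k))).
  assert (HP0 : forall k, 0 <= P k) by (intros; apply Rmax_l).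
  (* Intervals close to the origin, where [test_fun_lower] fails, get weight zero. *)
  set (m := fun k => if Compare_dec.le_dec K k then P k / 12 else 0).
  assert (Hm0 : forall k, 0 <= m k).
  { intros k. unfold m. destruct (Compare_dec.le_dec K k); [assert (A := HP0 k)|]; lra. }
  (* The denominator 12 in [m] makes 3 m_k at most the available decay exponent P_k / 4. *)
  assert (Hdec : forall k t, (1 <= k)%nat -> a k < t < b k ->
    Cmod (F (RtoC t)) <= CF * exp (- (3 * m k))).
  { intros k t Hk Ht.
    assert (D := decay_on_interval Lam Psi sigma F CF (a k) (b k) t Hsig_mono Ha HF HCF HB HL
      (proj1 Hsub k Hk) Ht). fold (P k) in D.
    eapply Rle_trans; [exact D|]. apply Rmult_le_compat_l; [lra|]. apply exp_monotone.
    unfold m. assert (A := HP0 k). destruct (Compare_dec.le_dec K k); lra. }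
  set (t := fun k => Psi (b k - a k) * ((b k - a k) / b k) ^ 2) in Hb.
  (* [e] compensates for the intervals of weight zero, so that the full sum in (b) can be used; its
     total does not depend on n. *)
  set (e := fun k => if Compare_dec.le_dec K k then 0 else Rabs (t k)).
  (* 192 = 12 * 4 * 4: the weight P_k / 12, the net slope 3/4 - 1/2 = 1/4, and t_k <= 4 P_k s_k with
     s_k the [inv_scale]. *)
  set (E := sum_n_m e 1 K / 192).
  assert (Hest : forall n, (1 <= n)%nat -> (K <= n)%nat -> y < 2 * b n -> Rabs x < 2 * b n ->
    Cmod (F (x, y)) <= CF * exp (y * (sigma (2 * b n) - sum_n_m t 1 n / 192 + E))).
  { intros n Hn HKn Hyn Hxn.
    eapply Rle_trans; [apply (bound_by_test_funs F sigma CF a b m n (x, y)); auto; now split|].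
    change (Im (x, y)) with y. apply Rmult_le_compat_l; [lra|]. apply exp_monotone.
    match goal with |- _ - sum_n_m ?w 1 n <= _ => set (W := w) end.
    assert (HS : sum_n_m (fun k => y / 192 * (t k + - e k)) 1 n <= sum_n_m W 1 n).
    { apply sum_le_compat. intros k Hk. unfold W, m, e.
      destruct (Compare_dec.le_dec K k) as [HKk|HKk].
      2:{ assert (A := Rle_abs (t k)). nra. }
      destruct (Hab0 k ltac:(lia)) as [Hak Hbk].
      assert (Hs := inv_scale_pos (a k) (b k) (conj Hak Hbk)).
      assert (Hbn : b k <= b n).
      { destruct (Nat.eq_dec k n) as [->|Hne]; [lra|].
        assert (A := Hord k n ltac:(lia) ltac:(lia)). assert (B := Hab n Hn). lra. }
      assert (Hlowk : 3 / 4 * y * inv_scale (a k) (b k) <= Re (test_fun (a k) (b k) (x, y))).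
      { apply Hlow; [now split|]. rewrite <- (Rinv_inv delta).
        apply Rinv_le_contravar; [now apply Rinv_0_lt_compat|]. left. now apply HK. }
      assert (Hslope : test_slope (a k) (b k) (2 * b n) <= inv_scale (a k) (b k) / 2).
      { unfold test_slope. apply (Rmult_le_reg_r ((2 * b n) ^ 2)); [apply pow_lt; lra|].
        unfold Rdiv at 1. rewrite Rmult_assoc, Rinv_l, Rmult_1_r by (apply pow_nonzero; lra).
        assert (b k ^ 2 <= b n ^ 2) by (apply pow_incr; lra).
        replace (inv_scale (a k) (b k) / 2 * (2 * b n) ^ 2) with (2 * inv_scale (a k) (b k) * b n ^ 2) by field.
        apply Rmult_le_compat_l; lra. }
      apply Rle_trans with (P k / 12 * (y * inv_scale (a k) (b k) / 4)).
      2:{ apply Rmult_le_compat_l; [assert (A := HP0 k); lra|].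
          apply Rmult_le_compat_r with (r := y) in Hslope; lra. }
      assert (Hts : (b k - a k) / b k ^ 2 <= 4 * inv_scale (a k) (b k)).
      { unfold inv_scale. replace (4 * ((/ a k - / b k) / 4)) with ((b k - a k) * / (a k * b k))
          by (field; lra).
        apply Rmult_le_compat_l; [lra|]. apply Rinv_le_contravar; nra. }
      assert (Ht : t k <= P k * (4 * inv_scale (a k) (b k))).
      { unfold t. replace (Psi (b k - a k) * ((b k - a k) / b k) ^ 2) with
          (Psi (b k - a k) * (b k - a k) * ((b k - a k) / b k ^ 2)) by (field; lra).
        apply Rle_trans with (P k * ((b k - a k) / b k ^ 2)).
        - apply Rmult_le_compat_r; [|apply Rmax_r].
          apply Rmult_le_pos; [lra|]. left. apply Rinv_0_lt_compat, pow_lt. lra.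
        - apply Rmult_le_compat_l; [apply HP0|exact Hts]. }
      nra. }
    assert (HS' : sum_n_m (fun k => y / 192 * (t k + - e k)) 1 n
      = y / 192 * (sum_n_m t 1 n - sum_n_m e 1 n) :> R).
    { clear. induction n as [|n IH]; [rewrite !sum_n_m_1_0; ring|].
      rewrite !sum_n_m_1_S, IH. ring. }
    rewrite HS', (sum_eventually_const e K) in HS; [|intros k Hk; unfold e|exact HKn].
    2:{ now destruct (Compare_dec.le_dec K k). }
    unfold E. lra. }
  destruct Hb as [nn [Hnn Hratio]].
  apply Cmod_eq_0. apply Rle_antisym; [|apply Cmod_ge_0].
  apply Rnot_lt_le. intros Hpos. set (c0 := Cmod (F (x, y))) in *.
  (* Once sigma(2 b_n) > X, sigma is positive, so the quotient in (b) can be cleared. A ratio above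
     384 = 2 * 192 then makes the exponent at most y (E - sigma(2 b_n)), hence at most - CF / c0. *)
  set (X := Rmax 1 (E + CF / (c0 * y))).
  assert (HX1 : 1 <= X) by apply Rmax_l. assert (HX2 : E + CF / (c0 * y) <= X) by apply Rmax_r.
  apply is_lim_spec in Hsig_inf. destruct (Hsig_inf X) as [Y0 HY0].
  assert (Hbinf : is_lim_seq (fun n => 2 * b n) p_infty).
  { apply is_lim_seq_le_p_loc with a; [|exact Hainf].
    exists 1%nat. intros n Hn. assert (A := Hab0 n Hn). lra. }
  destruct (is_lim_seq_p_infty_ge _ (Rmax Y0 (Rmax y (Rabs x))) Hbinf) as [N1 HN1].
  destruct (is_lim_seq_p_infty_ge _ (INR (N1 + K + 1)) Hnn) as [J1 HJ1].
  destruct (is_lim_seq_p_infty_ge _ 384 Hratio) as [J2 HJ2].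
  set (j := max J1 J2).
  specialize (HJ1 j ltac:(unfold j; lia)). specialize (HJ2 j ltac:(unfold j; lia)).
  apply INR_lt in HJ1. set (n := nn j) in *.
  specialize (HN1 n ltac:(lia)).
  assert (HA := Rmax_l Y0 (Rmax y (Rabs x))). assert (HA' := Rmax_r Y0 (Rmax y (Rabs x))).
  assert (HA1 := Rmax_l y (Rabs x)). assert (HA2 := Rmax_r y (Rabs x)).
  assert (Hsig : X < sigma (2 * b n)) by (apply HY0; lra).
  assert (HSum : 384 * sigma (2 * b n) < sum_n_m t 1 n).
  { apply Rmult_lt_compat_r with (r := sigma (2 * b n)) in HJ2; [|lra].
    assert (G : forall u v : R, 0 < v -> / v * u * v = u) by (intros; field; lra).
    rewrite G in HJ2 by lra. exact HJ2. }
  specialize (Hest n ltac:(lia) ltac:(lia) ltac:(lra) ltac:(lra)). fold c0 in Hest.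
  (* exp (- T) <= 1 / (1 + T) turns the estimate into c0 + CF <= CF, which contradicts c0 > 0. *)
  set (T := CF / c0).
  assert (HT : 0 < T) by now apply Rdiv_lt_0_compat.
  assert (Hexp : exp (y * (sigma (2 * b n) - sum_n_m t 1 n / 192 + E)) <= / (1 + T)).
  { apply Rle_trans with (exp (- T)).
    - apply exp_monotone.
      assert (HyT : T = y * (CF / (c0 * y))) by (unfold T; field; lra).
      assert (y * (sigma (2 * b n) - sum_n_m t 1 n / 192 + E) <= y * (- (CF / (c0 * y)))).
      { apply Rmult_le_compat_l; lra. }
      lra.
    - rewrite exp_Ropp. apply Rinv_le_contravar; [lra|].
      left. apply exp_ineq1. lra. }
  assert (Hfin : c0 <= CF * / (1 + T)).
  { eapply Rle_trans; [exact Hest|]. apply Rmult_le_compat_l; lra. }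
  apply Rmult_le_compat_r with (r := 1 + T) in Hfin; [|lra].
  rewrite Rmult_assoc, Rinv_l, Rmult_1_r in Hfin by lra.
  assert (c0 * T = CF) by (unfold T; field; lra). lra.
Qed.
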